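(* Let $n\ge 5$ and let $\mathbb{F}$ be a ring with unit (homology with coefficients in $\mathbb{F}$). Define \[P^{n-5}_d=\bigoplus_{s\ne t\in[4,n]}\langle 1s\wedge 2t\rangle\otimes\tilde H_d(\mathsf{M}[[4,n]\setminus\{s,t\}]),\qquad Q^{n-2}_d=\bigoplus_{u=4}^n\langle 3u\rangle\otimes\tilde H_d(\mathsf{M}[[n]\setminus\{3,u\}]\setminus 12).\] Then there is a long exact sequence \[\cdots\to Q^{n-2}_d\to\langle 13\rangle\otimes\tilde H_{d-1}(\mathsf{M}[[4,n]])\oplus P^{n-5}_{d-2}\to\tilde H_d(\mathsf{M}_n\setminus 12)\to Q^{n-2}_{d-1}\to\langle 13\rangle\otimes\tilde H_{d-2}(\mathsf{M}[[4,n]])\oplus P^{n-5}_{d-3}\to\cdots.\]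
   Context: For a finite set $S$, $\mathsf{M}[S]$ is the matching complex of the complete graph on $S$ (vertices: edges $ab=\{a,b\}$; faces: matchings); $\mathsf{M}_n=\mathsf{M}[[n]]$, $[a,b]=\{a,\dots,b\}$. For a complex $\mathsf{M}[T]$ with $1,2\in T$, $\mathsf{M}[T]\setminus 12$ is the subcomplex of matchings not containing the edge $12=\{1,2\}$. $\tilde H$ is reduced simplicial homology; $\langle\sigma\rangle\otimes H$ denotes a copy of $H$ indexed by $\sigma$; the sum defining $P$ is over ordered pairs of distinct $s,t$. *)

(* Defs.v *)
From HB Require Import structures.
From mathcomp Require Import all_boot all_order all_algebra.
From mathcomp Require Import boolp.

Set Implicit Arguments.
Unset Strict Implicit.
Unset Printing Implicit Defensive.

Import GRing.Theory.
Local Open Scope ring_scope.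

Section Submodule.
Variables (F : pzRingType) (V : lmodType F) (Z : submodClosed V).

Definition submodule : Type := {x : V | x \in Z}.
HB.instance Definition _ := SubChoice.on submodule.
HB.instance Definition _ := [SubChoice_isSubLmodule of submodule by <:].
End Submodule.

(* The additive group of V / B is the one of [ring_quotient]; only the scalar
   action is new. *)
Section QuotientModule.
Variables (F : pzRingType) (V : lmodType F) (B : submodClosed V).
Local Open Scope quotient_scope.

(* [submodClosed] does not provide closure under opposites by itself. *)
Definition mod_in : {pred V} := fun x => x \in B.
Fact mod_in_closed : subsemimod_closed mod_in.
Proof. by split; [exact: (rpred0D B) | exact: (@rpredZ _ _ B)]. Qed.
HB.instance Definition _ :=
  GRing.isSubmodClosed.Build F V mod_in mod_in_closed.

Definition quotmod : Type := Quotient.quot mod_in.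
HB.instance Definition _ := GRing.Zmodule.on quotmod.
HB.instance Definition _ := EqQuotient.on quotmod.

Definition quotmod_scale (a : F) (x : quotmod) : quotmod :=
  \pi_quotmod (a *: repr x).

Lemma pi_quotmodP (x y : V) :
  reflect (\pi_quotmod x = \pi_quotmod y) (x - y \in B).
Proof.
rewrite -[_ \in B]/(x - y \in mod_in) (Quotient.idealrBE mod_in).
exact: eqP.
Qed.

Lemma pi_quotmodB : {morph \pi_quotmod : x y / x - y}.
Proof. by move=> x y; apply: (raddfB (\pi_(Quotient.quot mod_in))). Qed.

Lemma pi_quotmodD : {morph \pi_quotmod : x y / x + y}.
Proof. by move=> x y; apply: (raddfD (\pi_(Quotient.quot mod_in))). Qed.

Lemma pi_quotmodZ a x : \pi_quotmod (a *: x) = quotmod_scale a (\pi_quotmod x).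
Proof.
apply/pi_quotmodP; rewrite -scalerBr rpredZ //; apply/pi_quotmodP.
by rewrite reprK.
Qed.

Fact quotmod_scaleA a b x :
  quotmod_scale a (quotmod_scale b x) = quotmod_scale (a * b) x.
Proof. by elim/quotW: x => x; rewrite -(pi_quotmodZ b) -!pi_quotmodZ scalerA. Qed.
Fact quotmod_scale1 : left_id 1 quotmod_scale.
Proof. by elim/quotW=> x; rewrite -!pi_quotmodZ scale1r. Qed.
Fact quotmod_scaleDr : right_distributive quotmod_scale +%R.
Proof.
move=> a; elim/quotW=> x; elim/quotW=> y.
by rewrite -pi_quotmodD -!pi_quotmodZ scalerDr pi_quotmodD.
Qed.
Fact quotmod_scaleDl x : {morph quotmod_scale^~ x : a b / a + b}.
Proof.
by move=> a b; elim/quotW: x => x; rewrite -!pi_quotmodZ scalerDl pi_quotmodD.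
Qed.
HB.instance Definition _ := GRing.Zmodule_isLmodule.Build F quotmod
  quotmod_scaleA quotmod_scale1 quotmod_scaleDr quotmod_scaleDl.
End QuotientModule.

(* MathComp has module structures on non-dependent finite functions only. *)
Section DirectSum.
Variables (F : pzRingType) (I : finType) (M : I -> lmodType F).

Definition dsum : Type := {dffun forall i, M i}.
HB.instance Definition _ := Choice.on dsum.
Implicit Types x y : dsum.

Definition dsum_zero : dsum := [ffun i => 0 : M i].
Definition dsum_opp x : dsum := [ffun i => - x i : M i].
Definition dsum_add x y : dsum := [ffun i => x i + y i : M i].
Definition dsum_scale (a : F) x : dsum := [ffun i => a *: x i : M i].

Fact dsum_addA : associative dsum_add.
Proof. by move=> x y z; apply/ffunP => i; rewrite !ffunE addrA. Qed.
Fact dsum_addC : commutative dsum_add.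
Proof. by move=> x y; apply/ffunP => i; rewrite !ffunE addrC. Qed.
Fact dsum_add0 : left_id dsum_zero dsum_add.
Proof. by move=> x; apply/ffunP => i; rewrite !ffunE add0r. Qed.
Fact dsum_addN : left_inverse dsum_zero dsum_opp dsum_add.
Proof. by move=> x; apply/ffunP => i; rewrite !ffunE addNr. Qed.
HB.instance Definition _ := GRing.isZmodule.Build dsum
  dsum_addA dsum_addC dsum_add0 dsum_addN.

Fact dsum_scaleA a b x : dsum_scale a (dsum_scale b x) = dsum_scale (a * b) x.
Proof. by apply/ffunP => i; rewrite !ffunE scalerA. Qed.
Fact dsum_scale1 : left_id 1 dsum_scale.
Proof. by move=> x; apply/ffunP => i; rewrite !ffunE scale1r. Qed.
Fact dsum_scaleDr : right_distributive dsum_scale +%R.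
Proof. by move=> a x y; apply/ffunP => i; rewrite !ffunE scalerDr. Qed.
Fact dsum_scaleDl x : {morph dsum_scale^~ x : a b / a + b}.
Proof. by move=> a b; apply/ffunP => i; rewrite !ffunE scalerDl. Qed.
HB.instance Definition _ := GRing.Zmodule_isLmodule.Build F dsum
  dsum_scaleA dsum_scale1 dsum_scaleDr dsum_scaleDl.
End DirectSum.

Definition exact_at (F : pzRingType) (A B C : lmodType F)
    (f : {linear A -> B}) (g : {linear B -> C}) : Prop :=
  forall y : B, g y = 0 <-> exists x : A, f x = y.

Record scomplex (T : finType) := SComplex {
  faces :> {set {set T}};
  faces_down : forall s t : {set T}, t \subset s -> s \in faces -> t \in faces }.

Section ReducedHomology.
Variables (F : pzRingType) (T : finType).

(* Chains of all complexes on T and of all degrees live in one module; the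
   chain group of K in degree d is cut out of it by a support condition. *)
Definition chain : lmodType F := {ffun {set T} -> F^o}.
Implicit Types (c : chain) (s t : {set T}) (K : scomplex T) (d : int).

(* Position of v in the face s, all faces being ordered by [enum_rank]. *)
Definition vpos (v : T) s : nat :=
  #|[set w in s | (enum_rank w < enum_rank v)%N]|.

(* The linear map sending s to \sum_(v in s) (-1)^(vpos v s) (s :\ v), given
   here by the coefficient of each t; the faces s with s :\ v = t for some
   v \in s are the v |: t with v \notin t. *)
Definition boundary c : chain :=
  [ffun t : {set T} =>
     \sum_(v | v \notin t) (-1) ^+ vpos v (v |: t) * c (v |: t)].

Fact boundary_is_linear : linear boundary.
Proof.
move=> a x y; apply/ffunP => t; rewrite !ffunE /= scaler_sumr -big_split /=.
apply: eq_bigr => v _; rewrite !ffunE mulrDr; congr (_ + _).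
by rewrite /GRing.scale /= !mulrA commr_sign.
Qed.
HB.instance Definition _ :=
  GRing.isLinear.Build F chain chain *:%R boundary boundary_is_linear.

Lemma boundaryK c : boundary (boundary c) = 0.
Proof.
apply/ffunP => t; rewrite !ffunE.
pose G v w : F := (-1) ^+ vpos v (v |: t) *
  ((-1) ^+ vpos w (w |: (v |: t)) * c (w |: (v |: t))).
pose P v w := [&& v \notin t, w \notin t & w != v].
transitivity (\sum_v \sum_(w | P v w) G v w).
  rewrite [RHS](bigID (fun v => v \notin t)) /= [X in _ + X]big1 ?addr0; last first.
    by move=> v vt; rewrite big_pred0 // => w; rewrite /P (negPf vt).
  apply: eq_bigr => v vt; rewrite ffunE mulr_sumr; apply: eq_bigl => w.
  by rewrite /P vt !inE negb_or andbC.
have sgn v w : P v w -> (enum_rank w < enum_rank v)%N -> G v w = - G w v.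
  case/and3P=> vt wt wv lt_wv; rewrite /G setUCA.
  have e1 : vpos v (v |: (w |: t)) = (vpos v (v |: t)).+1.
    rewrite /vpos (cardsD1 w) !inE eqxx lt_wv orbT add1n; congr _.+1.
    apply: eq_card => x; rewrite !inE; case: (eqVneq x w) => [->|] //=.
    by rewrite (negPf wt) (negPf wv).
  have e2 : vpos w (w |: (v |: t)) = vpos w (w |: t).
    rewrite /vpos; apply: eq_card => x; rewrite !inE.
    case: (eqVneq x v) => [->|] //=.
    by rewrite [(_ < _)%N]ltnNge (ltnW lt_wv) !andbF.
  rewrite setUCA e2 setUCA e1 exprS mulN1r mulNr mulrN opprK !mulrA.
  by rewrite -!exprD addnC.
rewrite pair_big_dep /=.
rewrite (bigID (fun p : T * T => (enum_rank p.2 < enum_rank p.1)%N)) /=.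
rewrite [X in X + _](eq_bigr (fun p => - G p.2 p.1)); last first.
  by move=> p /andP[Pp lt_p]; apply: sgn.
rewrite sumrN (reindex_inj (h := fun p : T * T => (p.2, p.1))) /=; last first.
  by move=> [a b] [a' b'] [-> ->].
rewrite addrC; apply/eqP; rewrite subr_eq0; apply/eqP.
apply: eq_bigl => -[v w] /=; rewrite /P -leqNgt leq_eqVlt.
rewrite [RHS](_ : _ = [&& v \notin t, w \notin t & w != v] &&
   (enum_rank v < enum_rank w)%N); last first.
  by rewrite andbCA eq_sym.
case: (eqVneq w v) => [|wv]; first by rewrite !andbF.
by rewrite (inj_eq val_inj) (inj_eq enum_rank_inj) eq_sym (negPf wv).
Qed.

Section Degree.
Variables (K : scomplex T) (d : int).

(* A face of dimension d has d + 1 vertices; the empty face has dimension -1,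
   so this is the augmented (reduced) chain complex. *)
Definition chains : {pred chain} :=
  [pred c : chain | [forall s, (c s != 0) ==>
                               (s \in faces K) && (#|s|%:Z == d + 1)]].

Lemma chainsP c :
  reflect (forall s, ~~ ((s \in faces K) && (#|s|%:Z == d + 1)) -> c s = 0)
          (c \in chains).
Proof.
apply: (iffP forallP) => h s; last first.
  by apply/implyP; apply: contraNT => /h ->.
by move=> ns; apply/eqP; apply: contraNT ns => /(implyP (h s)).
Qed.

Fact chains_closed : subsemimod_closed chains.
Proof.
split; first split.
- by apply/chainsP => s _; rewrite ffunE.
- move=> x y /chainsP hx /chainsP hy; apply/chainsP => s ns.
  by rewrite ffunE hx // hy // addr0.
- move=> a x /chainsP hx; apply/chainsP => s ns.
  by rewrite ffunE hx // scaler0.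
Qed.
HB.instance Definition _ :=
  GRing.isSubmodClosed.Build F chain chains chains_closed.

Definition cycles : {pred chain} :=
  [pred c | (c \in chains) && (boundary c == 0)].

Fact cycles_closed : subsemimod_closed cycles.
Proof.
split; first split.
- by rewrite inE rpred0 raddf0 eqxx.
- move=> x y /andP[hx /eqP bx] /andP[hy /eqP by_].
  by rewrite inE rpredD // raddfD /= bx by_ addr0 eqxx.
- move=> a x /andP[hx /eqP bx].
  by rewrite inE rpredZ // linearZ /= bx scaler0 eqxx.
Qed.
HB.instance Definition _ :=
  GRing.isSubmodClosed.Build F chain cycles cycles_closed.
End Degree.

Definition boundaries K d : {pred submodule (cycles K d)} :=
  [pred z | `[< exists2 b, b \in chains K (d + 1) & boundary b = val z >]].
Arguments boundaries K d : clear implicits.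

Fact boundaries_closed K d : subsemimod_closed (boundaries K d).
Proof.
split; first split.
- by apply/asboolP; exists 0; rewrite ?rpred0 ?raddf0.
- move=> x y /asboolP[b hb bx] /asboolP[b' hb' by_]; apply/asboolP.
  by exists (b + b'); rewrite ?rpredD // raddfD /= bx by_.
- move=> a x /asboolP[b hb bx]; apply/asboolP.
  by exists (a *: b); rewrite ?rpredZ // linearZ /= bx.
Qed.
HB.instance Definition _ K d :=
  GRing.isSubmodClosed.Build F (submodule (cycles K d)) (boundaries K d)
    (boundaries_closed K d).

(* By [boundary_cycle], [boundaries] is the whole image of the boundary map. *)
Lemma boundary_cycle K d c :
  c \in chains K (d + 1) -> boundary c \in cycles K d.
Proof.
move=> /chainsP hc; rewrite inE boundaryK eqxx andbT; apply/chainsP => t nt.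
rewrite ffunE big1 // => v vt; rewrite hc ?mulr0 //; apply: contra nt.
case/andP=> sK; rewrite cardsU1 vt PoszD addrC (inj_eq (addIr _)) => ->.
by rewrite (faces_down (subsetUr _ _) sK).
Qed.

Definition homology K d : lmodType F := quotmod (boundaries K d).

End ReducedHomology.

(* Edges of the complete graph on S are two-element subsets of S, so a matching
   is a set of such edges that are pairwise disjoint. *)
Section Matchings.
Variable V : finType.

Definition is_matching (S : {set V}) (m : {set {set V}}) : bool :=
  [forall e in m, (e \subset S) && (#|e| == 2)] && trivIset m.

Fact is_matching_down (S : {set V}) (m m' : {set {set V}}) :
  m' \subset m -> m \in [set m | is_matching S m] ->
  m' \in [set m | is_matching S m].
Proof.
move=> sm; rewrite !inE => /andP[/forall_inP hm tm]; apply/andP; split.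
  by apply/forall_inP => e /(subsetP sm)/hm.
exact: trivIsetS tm.
Qed.

Definition matching_complex (S : {set V}) : scomplex {set V} :=
  SComplex (@is_matching_down S).
End Matchings.

Section Deletion.
Variables (T : finType) (K : scomplex T) (v : T).

Fact deletion_down (s t : {set T}) :
  t \subset s -> s \in [set s in faces K | v \notin s] ->
  t \in [set s in faces K | v \notin s].
Proof.
move=> ts; rewrite !inE => /andP[sK vs].
by rewrite (faces_down ts sK) (contra (subsetP ts v) vs).
Qed.

Definition deletion : scomplex T := SComplex deletion_down.
End Deletion.

(* The vertices 1, ..., n are the elements of 'I_n.+1 with these values; 0 is
   not used. *)
Section Terms.
Variables (F : pzRingType) (n : nat).
Local Notation V := 'I_n.+1.

Definition itv (a b : nat) : {set V} := [set i : V | (a <= i <= b)%N].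

Definition edge (a b : V) : {set V} := [set a; b].

Definition edge12 : {set V} := edge (inord 1) (inord 2).

(* \tilde H_d (M_n \ 12) *)
Definition Hdel (d : int) : lmodType F :=
  homology F (deletion (matching_complex (itv 1 n)) edge12) d.

(* \tilde H_d (M[[4,n]]) *)
Definition H4 (d : int) : lmodType F := homology F (matching_complex (itv 4 n)) d.

(* The ordered pair (s, t) indexes the summand of 1s /\ 2t. *)
Definition Pindex : finType :=
  {st : V * V | [&& st.1 \in itv 4 n, st.2 \in itv 4 n & st.1 != st.2]}.

Definition P (d : int) : lmodType F :=
  dsum (fun st : Pindex =>
    homology F
      (matching_complex (itv 4 n :\: [set (val st).1; (val st).2])) d).

(* u indexes the summand of the edge 3u. *)
Definition Qindex : finType := {u : V | u \in itv 4 n}.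

Definition Q (d : int) : lmodType F :=
  dsum (fun u : Qindex =>
    homology F
      (deletion (matching_complex (itv 1 n :\: [set inord 3; val u])) edge12) d).

End Terms.

(* Main.v *)
(* Let K = M_n \ 12, N = M[[4,n]], and let A be the subcomplex of K formed by the
   matchings without any edge 3u, u >= 4.  Removing 3u identifies the relative
   chains of (K, A) with the sum of the chain complexes of the links, shifted by
   one, so the sequence is the long exact sequence of the pair (K, A) once the
   homology of A is known.  A matching in A contains at most one of the edges
   13, 1s and at most one of 23, 2t; pairing m with m + 13 (m free at 1 and 3)
   and 1s + m with 1s + 23 + m (m free at 2 and 3) leaves the cells 23 + m with
   m in N, and 1s + 2t + m with m in M[[4,n] \ {s,t}].  The differential of
   1s ^ 2t ^ x meets the first family in (13 - 23) ^ x, which is null-homotopic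
   through (13 - 23) ^ st ^ x, so the homology of A splits as stated.  All this is
   carried out with the operators "join with e" and "contract e" on chains, which
   satisfy the relations of exterior multiplication and contraction. *)

(* The operators act on arbitrary functions on sets of edges, so their relations carry no conditions
   on faces or degrees; supports are checked separately. Contraction anticommutes with the boundary,
   and boundary (e ^ c) = c - e ^ boundary c; these two rules replace computations with signs of
   faces. The compatibility of [psiN] with the boundary and the homotopy formula are proved for
   chains of A: both are linear in the chain, so they are tested on joins of edges at 1 and 2 with a
   chain that has no edge at 1, 2 or 3. The obstacle is that discarding the faces with an edge at a
   given vertex is not a chain map, so the projection to the remaining cells needs correction terms.
   Explicit maps in both directions, with a homotopy for one composite, then work over any ring: no
   ranks enter, and signs are the only coefficients. For a cycle y in the link of 3u, the boundary
   of 3u ^ y is y. The connecting map of the pair is therefore summation of the link cycles inside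
   A, followed by the splitting. *)
Require Import Defs.
From mathcomp Require Import all_boot all_order all_algebra.
Import GRing.Theory.
Local Open Scope ring_scope.
From HB Require Import structures.
From mathcomp Require Import boolp zify.
Set Implicit Arguments.
Unset Strict Implicit.
Unset Printing Implicit Defensive.

(* The ring tactic does not apply to a bare zmodType; equations there are
   decided by comparing integer coefficients. *)
Inductive zmod_expr :=
  | ZZero | ZVar of nat | ZAdd of zmod_expr & zmod_expr | ZOpp of zmod_expr.

Fixpoint zmod_coef (e : zmod_expr) (i : nat) : int :=
  match e with
  | ZZero => 0
  | ZVar j => (i == j)%:Z
  | ZAdd a b => zmod_coef a i + zmod_coef b i
  | ZOpp a => - zmod_coef a i
  end.

Section ZmodNormalization.
Variable V : zmodType.

Fixpoint zmod_eval (env : seq V) (e : zmod_expr) : V :=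
  match e with
  | ZZero => 0
  | ZVar j => nth 0 env j
  | ZAdd a b => zmod_eval env a + zmod_eval env b
  | ZOpp a => - zmod_eval env a
  end.

Lemma zmod_evalE env e :
  zmod_eval env e = \sum_(i < size env) env`_i *~ zmod_coef e i.
Proof.
elim: e => [|j|a IHa b IHb|a IHa] /=; rewrite ?IHa ?IHb.
- by rewrite big1 // => i _; rewrite mulr0z.
- have [ltj|gej] := ltnP j (size env).
    rewrite (bigD1 (Ordinal ltj)) //= eqxx mulr1z big1 ?addr0 // => i nij.
    by rewrite (_ : (i == j :> nat) = false) ?mulr0z //; apply: negbTE.
  rewrite nth_default // big1 // => i _.
  rewrite (_ : (i == j :> nat) = false) ?mulr0z //; apply/eqP => eij.
  by move: (ltn_ord i); rewrite eij ltnNge gej.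
- by rewrite -big_split; apply: eq_bigr => i _; rewrite mulrzDr.
- by rewrite -sumrN; apply: eq_bigr => i _; rewrite mulrNz.
Qed.

Lemma zmod_eval_eq env e1 e2 :
    all (fun i => zmod_coef e1 i == zmod_coef e2 i) (iota 0 (size env)) ->
  zmod_eval env e1 = zmod_eval env e2.
Proof.
move=> /allP eq_coef; rewrite !zmod_evalE; apply: eq_bigr => i _.
by rewrite (eqP (eq_coef i _)) // mem_iota ltn_ord.
Qed.
End ZmodNormalization.

(** The [match constr:(Set)] lets a tactic that returns a term backtrack when unification fails;
    atoms are thus compared up to conversion. *)
Ltac zmod_index x env :=
  lazymatch env with
  | ?y :: ?env' => match constr:(Set) with
                   | _ => let _ := match constr:(Set) with _ => unify x y end in
                          constr:(0%N)
                   | _ => let k := zmod_index x env' in constr:(k.+1)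
                   end
  | _ => fail "not found"
  end.
Ltac zmod_env env e :=
  lazymatch e with
  | (?a + ?b)%R => let env1 := zmod_env env a in zmod_env env1 b
  | (- ?a)%R => zmod_env env a
  | 0%R => env
  | ?x => match constr:(Set) with
          | _ => let _ := zmod_index x env in env
          | _ => constr:(x :: env)
          end
  end.
Ltac zmod_reify env e :=
  lazymatch e with
  | (?a + ?b)%R => let a' := zmod_reify env a in
                   let b' := zmod_reify env b in constr:(ZAdd a' b')
  | (- ?a)%R => let a' := zmod_reify env a in constr:(ZOpp a')
  | 0%R => constr:(ZZero)
  | ?x => let k := zmod_index x env in constr:(ZVar k)
  end.
Ltac zmod_solve :=
  lazymatch goal with
  | |- @eq ?V ?a ?b =>
    let env0 := zmod_env (@nil V) a in
    let env := zmod_env env0 b in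
    let a' := zmod_reify env a in
    let b' := zmod_reify env b in
    exact: (@zmod_eval_eq _ env a' b' isT)
  end.

(** * Exterior multiplication and contraction *)

Section ExteriorOperators.
Variables (F : pzRingType) (T : finType).
Local Notation chain := (chain F T).
Implicit Types (c : chain) (s t : {set T}) (e f : T).

(** On faces: s goes to the signed face s :\ e if e is in s, and to 0 otherwise, so [boundary] is
    the sum of these over e. The [odd] in the exponent puts signs in the form that [mulr_sign]
    resolves by cases. *)
Definition contract e c : chain :=
  [ffun t : {set T} =>
     if e \in t then 0 else (-1) ^+ odd (vpos e t) * c (e |: t)].

(** Joins with e even where e meets an edge of the face; whether the result is a chain of matchings
    is a matter of supports. *)
Definition wedge e c : chain :=
  [ffun t : {set T} =>
     if e \in t then (-1) ^+ odd (vpos e t) * c (t :\ e) else 0].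

Definition restrict (Q : pred {set T}) c : chain :=
  [ffun t : {set T} => if Q t then c t else 0].

Fact contract_is_linear e : linear (contract e).
Proof.
move=> a x y; apply/ffunP => t; rewrite !ffunE; case: ifP => _.
  by rewrite scaler0 addr0.
by rewrite !mulr_sign; case: odd; rewrite // opprD scalerN.
Qed.
HB.instance Definition _ e :=
  GRing.isLinear.Build F chain chain *:%R (contract e) (contract_is_linear e).

Fact wedge_is_linear e : linear (wedge e).
Proof.
move=> a x y; apply/ffunP => t; rewrite !ffunE; case: ifP => _; last first.
  by rewrite scaler0 addr0.
by rewrite !mulr_sign; case: odd; rewrite // opprD scalerN.
Qed.
HB.instance Definition _ e :=
  GRing.isLinear.Build F chain chain *:%R (wedge e) (wedge_is_linear e).

Fact restrict_is_linear Q : linear (restrict Q).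
Proof.
move=> a x y; apply/ffunP => t; rewrite !ffunE; case: ifP => _ //.
by rewrite scaler0 addr0.
Qed.
HB.instance Definition _ Q :=
  GRing.isLinear.Build F chain chain *:%R (restrict Q) (restrict_is_linear Q).

Lemma vpos_setU1 e f t :
  f \notin t ->
  vpos e (f |: t) = ((enum_rank f < enum_rank e) + vpos e t)%N.
Proof.
move=> nft; rewrite /vpos.
have [lt_fe|le_ef] := boolP (enum_rank f < enum_rank e)%N.
  rewrite (cardsD1 f) !inE eqxx lt_fe; congr (_ + _)%N; apply: eq_card => x.
  by rewrite !inE; case: (eqVneq x f) => [->|]; rewrite ?(negPf nft).
apply: eq_card => x; rewrite !inE.
by case: (eqVneq x f) => [->|] //=; rewrite (negPf le_ef) andbF.
Qed.

Lemma vpos_self e t : vpos e (e |: t) = vpos e t.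
Proof.
apply: eq_card => x; rewrite !inE; case: (eqVneq x e) => [->|] //=.
by rewrite ltnn andbF.
Qed.

Lemma boundaryE c : boundary c = \sum_e contract e c.
Proof.
apply/ffunP => t; rewrite ffunE sum_ffunE big_mkcond; apply: eq_bigr => e _.
by rewrite ffunE vpos_self signr_odd; case: (e \in t).
Qed.

(** Exactly one of two distinct vertices precedes the other; this asymmetry is the source of the
    sign in each anticommutation below. *)
Lemma rank_lt_neg e f :
  e != f -> (enum_rank f < enum_rank e)%N = ~~ (enum_rank e < enum_rank f)%N.
Proof.
move=> nef; rewrite ltnNge leq_eqVlt negb_or.
by rewrite (inj_eq val_inj) (inj_eq enum_rank_inj) nef.
Qed.

Lemma contract_contract e c : contract e (contract e c) = 0.
Proof.
by apply/ffunP => t; rewrite !ffunE setU11 mulr0; case: ifP.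
Qed.

Lemma contractC e f c : contract e (contract f c) = - contract f (contract e c).
Proof.
have [->|nef] := eqVneq e f; first by rewrite contract_contract oppr0.
apply/ffunP => t; rewrite !ffunE !inE (negPf nef) eq_sym (negPf nef) /=.
have [et|net] := boolP (e \in t); have [ft|nft] := boolP (f \in t);
  rewrite ?mulr0 ?oppr0 // setUCA !vpos_setU1 // !oddD !oddb.
rewrite (rank_lt_neg nef) !mulr_sign.
by case: (_ < _)%N; case: odd; case: odd; rewrite /= ?opprK.
Qed.

Lemma wedgeC e f c : wedge e (wedge f c) = - wedge f (wedge e c).
Proof.
have wedge2 g x : wedge g (wedge g x) = 0.
  by apply/ffunP => t; rewrite !ffunE setD11 mulr0; case: ifP.
have [->|nef] := eqVneq e f; first by rewrite wedge2 oppr0.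
apply/ffunP => t; rewrite !ffunE !inE (negPf nef) eq_sym (negPf nef) /=.
have [et|net] := boolP (e \in t); have [ft|nft] := boolP (f \in t);
  rewrite ?mulr0 ?oppr0 //.
have -> : t :\ f :\ e = t :\ e :\ f by apply/setP => x; rewrite !inE andbCA.
rewrite -[in vpos e t](setD1K ft) -[in vpos f t](setD1K et).
rewrite !vpos_setU1 ?setD11 // !oddD !oddb.
rewrite (rank_lt_neg nef) !mulr_sign.
by case: (_ < _)%N; case: odd; case: odd; rewrite /= ?opprK.
Qed.

Lemma contract_wedge e c : contract e (wedge e c) = c - wedge e (contract e c).
Proof.
apply/ffunP => t; rewrite !ffunE !inE eqxx /=.
have [et|net] := boolP (e \in t); rewrite ?subr0 ?setU1K ?vpos_self //.
  have -> : vpos e (t :\ e) = vpos e t by rewrite -{2}(setD1K et) vpos_self.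
  by rewrite setD1K // mulrA -signr_addb addbb mul1r subrr.
by rewrite mulrA -signr_addb addbb mul1r.
Qed.

Lemma contract_wedgeN e f c :
  e != f -> contract e (wedge f c) = - wedge f (contract e c).
Proof.
move=> nef; apply/ffunP => t; rewrite !ffunE !inE eq_sym (negPf nef) /=.
have [ft|nft] := boolP (f \in t); last by rewrite mulr0 if_same oppr0.
have [et|net] := boolP (e \in t); first by rewrite mulr0 oppr0.

have -> : (e |: t) :\ f = e |: (t :\ f).
  by apply/setP => x; rewrite !inE; case: (eqVneq x e) => [->|] //; rewrite nef.
rewrite vpos_setU1 // -[in vpos e t](setD1K ft) vpos_setU1 ?setD11 //.
rewrite !oddD !oddb (rank_lt_neg nef) !mulr_sign.
by case: (_ < _)%N; case: odd; case: odd; rewrite /= ?opprK.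
Qed.

Lemma boundary_contract e c : boundary (contract e c) = - contract e (boundary c).
Proof.
rewrite !boundaryE linear_sum -sumrN.
by apply: eq_bigr => f _; apply: contractC.
Qed.

(* Joining with a vertex is a contracting homotopy of the full simplex. *)
Lemma boundary_wedge e c : boundary (wedge e c) = c - wedge e (boundary c).
Proof.
rewrite !boundaryE linear_sum [X in _ = c - X](bigD1 e) //=.
rewrite [LHS](bigD1 e) //= contract_wedge.
rewrite opprD addrA -sumrN; congr (_ + _); apply: eq_bigr => f nfe.
exact: contract_wedgeN.
Qed.
End ExteriorOperators.

(** * Supports of joins, contractions and restrictions *)

Section ChainMembership.
Variables (F : pzRingType) (T : finType).
Implicit Types (K : scomplex T) (d : int) (e : T) (c : chain F T).

(** The two operators carry the same sign, which cancels, leaving the projection to the faces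
    through e. *)
Lemma wedge_contractE e c (t : {set T}) :
  wedge e (contract e c) t = if e \in t then c t else 0.
Proof.
rewrite !ffunE; case: ifP => // et; rewrite setD11 setD1K //.
have -> : vpos e (t :\ e) = vpos e t by rewrite -{2}(setD1K et) vpos_self.
by rewrite mulrA -signr_addb addbb mul1r.
Qed.

Lemma chains_subset K K' d c :
  faces K \subset faces K' -> c \in chains K d -> c \in chains K' d.
Proof.
move=> /subsetP sK /chainsP hc; apply/chainsP => s ns; apply: hc.
by apply: contra ns => /andP[/sK-> ->].
Qed.

Lemma chains_wedge K K' e d d' c :
    (forall t, t \in faces K' -> e \notin t -> e |: t \in faces K) ->
    d = d' + 1 ->
  c \in chains K' d' -> wedge e c \in chains K d.
Proof.
move=> hK -> /chainsP hc; apply/chainsP => s ns; rewrite ffunE.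
case: ifP => // es; rewrite hc ?mulr0 //; apply: contra ns => /andP[sK' sd].
have := hK _ sK'; rewrite setD11 setD1K // => -> //=.
by rewrite (cardsD1 e) es PoszD (eqP sd) addrC.
Qed.

Lemma chains_contract K K' e d d' c :
    (forall s, s \in faces K -> e \in s -> s :\ e \in faces K') ->
    d = d' + 1 ->
  c \in chains K d -> contract e c \in chains K' d'.
Proof.
move=> hK -> /chainsP hc; apply/chainsP => t nt; rewrite ffunE.
case: ifPn => // net; rewrite hc ?mulr0 //; apply: contra nt => /andP[tK td].
have := hK _ tK (setU11 _ _); rewrite setU1K // => -> /=.
by move: td; rewrite cardsU1 net PoszD addrC (inj_eq (addIr _)).
Qed.

Lemma chains_restrict K K' (Q : pred {set T}) d c :
    (forall s, s \in faces K -> Q s -> s \in faces K') ->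
  c \in chains K d -> restrict Q c \in chains K' d.
Proof.
move=> hK /chainsP hc; apply/chainsP => s ns; rewrite ffunE.
case: ifP => // Qs; apply: hc; apply: contra ns => /andP[sK ->].
by rewrite hK.
Qed.

End ChainMembership.

(** * Projection to the faces that leave a vertex uncovered *)

Section Avoid.
Variables (F : pzRingType) (V : finType).
Local Notation chain := (chain F {set V}).
Implicit Types (c : chain) (v : V) (e : {set V}).

Definition avoid v : chain -> chain :=
  restrict (fun s : {set {set V}} => v \notin cover s).
HB.instance Definition _ v := GRing.Linear.on (avoid v).

Lemma cover_setU1 e (t : {set {set V}}) : cover (e |: t) = e :|: cover t.
Proof. by rewrite /cover bigcup_setU big_set1. Qed.

Lemma avoid_wedge v e c : v \notin e -> avoid v (wedge e c) = wedge e (avoid v c).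
Proof.
move=> nve; apply/ffunP => t; rewrite !ffunE; have [et|_] := boolP (e \in t).
  rewrite -{1}(setD1K et) cover_setU1 inE (negPf nve) /=.
  by case: ifP; rewrite ?mulr0.
by case: ifP.
Qed.

Lemma avoid_wedge0 v e c : v \in e -> avoid v (wedge e c) = 0.
Proof.
move=> ve; apply/ffunP => t; rewrite !ffunE; have [et|_] := boolP (e \in t).
  by rewrite -{1}(setD1K et) cover_setU1 inE ve.
by case: ifP.
Qed.

Lemma avoid_contract v e c :
  v \notin e -> avoid v (contract e c) = contract e (avoid v c).
Proof.
move=> nve; apply/ffunP => t; rewrite !ffunE cover_setU1 inE (negPf nve) /=.
by case: ifP; case: ifP; rewrite ?mulr0.
Qed.

Lemma contract_avoid v e c : v \in e -> contract e (avoid v c) = 0.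
Proof.
move=> ve; apply/ffunP => t; rewrite !ffunE cover_setU1 inE ve /= mulr0.
by case: ifP.
Qed.

Lemma avoidC v w c : avoid v (avoid w c) = avoid w (avoid v c).
Proof. by apply/ffunP => t; rewrite !ffunE; case: ifP; case: ifP. Qed.

Lemma contract_avoided v e c : avoid v c = c -> v \in e -> contract e c = 0.
Proof. by move=> <-; apply: contract_avoid. Qed.

(** The hypothesis matters: removing the edge at v from a face through v creates a face free at v,
    so [avoid v] is not a chain map. *)
Lemma avoid_boundary v c : avoid v c = c -> avoid v (boundary c) = boundary c.
Proof.
move=> hc; rewrite boundaryE linear_sum; apply: eq_bigr => e _ /=.
have [ve|nve] := boolP (v \in e); last by rewrite avoid_contract ?hc.
by rewrite (contract_avoided hc ve) linear0.
Qed.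
End Avoid.

(** * Matchings *)

Section MatchingsAvoidingEdges.
Variable V : finType.
Implicit Types (S : {set V}) (X s t : {set {set V}}) (e : {set V}).

Lemma is_matchingE S s :
  is_matching S s =
    [&& cover s \subset S, [forall e in s, #|e| == 2] & trivIset s].
Proof.
rewrite /is_matching andbA; congr (_ && _); apply/forall_inP/andP.
  move=> h; split; last by apply/forall_inP => e /h /andP[].
  by apply/bigcupsP => e /h /andP[].
by case=> /bigcupsP h /forall_inP h2 e es; rewrite h // h2.
Qed.

Fact matchings_down S X s t :
  t \subset s -> s \in [set m | is_matching S m && [disjoint m & X]] ->
  t \in [set m | is_matching S m && [disjoint m & X]].
Proof.
move=> ts; rewrite !inE => /andP[sS sX]; rewrite (disjointWl ts sX) andbT.
by have := is_matching_down (S := S) ts; rewrite !inE => ->.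
Qed.

(** One family for all complexes of the proof: X empty gives the faces of M[S], X = {12} those of
    the deletion, and X = [forbidden] with S = [1,n] gives A. *)
Definition matchings S X : scomplex {set V} := SComplex (@matchings_down S X).

Lemma in_matchings S X s :
  (s \in faces (matchings S X)) = is_matching S s && [disjoint s & X].
Proof. by rewrite inE. Qed.

Lemma matchings_setU1 S S' X e t :
    e \subset S -> #|e| = 2 -> [disjoint e & S'] -> S' \subset S -> e \notin X ->
  t \in faces (matchings S' X) -> e |: t \in faces (matchings S X).
Proof.
move=> eS e2 eS' S'S neX; rewrite !in_matchings !is_matchingE.
case/andP=> /and3P[tS' t2 tt] tX; rewrite cover_setU1 subUset eS.
have eX : [disjoint e |: t & X].
  rewrite disjoint_subset; apply/subsetP => f /setU1P[->|ft] //.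
  by rewrite inE (disjointFr tX ft).
rewrite (subset_trans tS') //= eX andbT; apply/andP; split.
  by apply/forall_inP => f /setU1P[->|/(forall_inP t2)] //; apply/eqP.
apply: (proj1 (trivIsetU1 _ tt _)) => [f ft|].
  by apply: disjointWr eS'; apply: subset_trans tS'; apply: (bigcup_sup f).
apply/negP => /(forall_inP t2); by rewrite cards0.
Qed.

(** With [matchings_setU1] this identifies the link of an allowed edge e with the matchings on S
    minus e. *)
Lemma matchings_setD1 S X e s :
  s \in faces (matchings S X) -> e \in s ->
  s :\ e \in faces (matchings (S :\: e) X).
Proof.
rewrite !in_matchings !is_matchingE => /andP[/and3P[sS s2 st] sX] es.
rewrite (disjointWl (subsetDl _ _) sX) andbT.
rewrite (trivIsetS (subsetDl _ _) st) andbT; apply/andP; split; last first.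
  by apply/forall_inP => f /setD1P[_ fs]; apply: (forall_inP s2).
apply/bigcupsP => f /setD1P[nfe fs]; rewrite subsetD.
rewrite (trivIsetP st) // andbT; apply: subset_trans sS.
exact: (bigcup_sup f).
Qed.

Lemma matchings_edge S X e s :
  s \in faces (matchings S X) -> e \in s ->
  [/\ e \subset S, #|e| = 2 & e \notin X].
Proof.
rewrite in_matchings => /andP[/andP[/forall_inP h _] sX] es.
have /andP[-> /eqP->] := h _ es; split=> //.
by apply/negP => eX; move/disjoint_setI0: sX => /setP/(_ e); rewrite !inE es eX.
Qed.

(** A matching sees the ground set only through its cover, and only the forbidden edges inside S'
    matter; this serves both to shrink and to enlarge ground sets. *)
Lemma matchings_cover S S' X X' s :
    s \in faces (matchings S X) -> cover s \subset S' ->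
    (forall e, e \in X' -> e \subset S' -> e \in X) ->
  s \in faces (matchings S' X').
Proof.
move=> sK sS' hX; move: (sK); rewrite !in_matchings !is_matchingE.
case/andP=> /and3P[_ -> ->] sX; rewrite sS' /=.
rewrite disjoint_subset; apply/subsetP => e es; apply/negP => eX'.
have [_ _ /negP[]] := matchings_edge sK es; apply: hX => //.
by apply: subset_trans sS'; apply: (bigcup_sup e).
Qed.

Lemma matchings_trivI S X s e f v :
    s \in faces (matchings S X) -> e \in s -> f \in s -> v \in e -> v \in f ->
  e = f.
Proof.
rewrite in_matchings => /andP[/andP[_ /trivIsetP st] _] es fs ve vf.
apply: contraTeq ve => nef; have /disjoint_setI0/setP/(_ v) := st _ _ es fs nef.
by rewrite !inE vf andbT => ->.
Qed.
End MatchingsAvoidingEdges.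

(** A matching has at most one edge at v, so each face is either free at v or counted by exactly one
    term of the sum. Edges of r that occur in no face contribute 0. *)
Lemma chains_split (F : pzRingType) (V : finType) (S : {set V})
    (X : {set {set V}}) (v : V) (r : seq {set V}) (d : int)
    (c : chain F {set V}) :
    uniq r -> (forall e, e \in r -> v \in e) ->
    (forall s e, s \in faces (matchings S X) -> e \in s -> v \in e -> e \in r) ->
    c \in chains (matchings S X) d ->
  c = avoid v c + \sum_(e <- r) wedge e (contract e c).
Proof.
move=> ur rv hr /chainsP hc; apply/ffunP => t; rewrite ffunE sum_ffunE ffunE.
under eq_bigr do rewrite wedge_contractE.
have [tK|ntK] := boolP (t \in faces (matchings S X)); last first.
  rewrite hc ?(negPf ntK) // big1 ?if_same ?addr0 // => e _; exact: if_same.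
case: ifPn => [nvt|].
  rewrite big_seq big1 ?addr0 // => e er; case: ifP => // et.
  by case/bigcupP: nvt; exists e => //; apply: rv.
rewrite negbK => /bigcupP[e et ve]; have er := hr _ _ tK et ve.
rewrite (bigD1_seq e) //= et add0r big_seq_cond big1 ?addr0 // => f.
case/andP=> fr nfe; case: ifP => // ft; case/eqP: nfe.
exact: (matchings_trivI tK ft et (rv _ fr) ve).
Qed.
(** * Homology classes and their representatives *)

Section HomologyClasses.
Variables (F : pzRingType) (T : finType).
Implicit Types (K : scomplex T) (d : int) (c : chain F T).
Local Open Scope quotient_scope.

(** The counterpart of [boundaries] on plain chains instead of the subtype of cycles, so that
    classes are compared by chain computations. *)
Definition bounding K d : {pred chain F T} :=
  [pred c | `[< exists2 b, b \in chains K (d + 1) & boundary b = c >]].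

Lemma boundingP K d c :
  reflect (exists2 b, b \in chains K (d + 1) & boundary b = c)
          (c \in bounding K d).
Proof. exact: asboolP. Qed.

Fact bounding_closed K d : subsemimod_closed (bounding K d).
Proof.
split; first split.
- by apply/boundingP; exists 0; rewrite ?rpred0 ?raddf0.
- move=> x y /boundingP[b hb bx] /boundingP[b' hb' by_]; apply/boundingP.
  by exists (b + b'); rewrite ?rpredD // raddfD /= bx by_.
- move=> a x /boundingP[b hb bx]; apply/boundingP.
  by exists (a *: b); rewrite ?rpredZ // linearZ /= bx.
Qed.
HB.instance Definition _ K d :=
  GRing.isSubmodClosed.Build F (chain F T) (bounding K d) (bounding_closed K d).

Lemma cyclesP K d c :
  reflect (c \in chains K d /\ boundary c = 0) (c \in cycles K d).
Proof. by apply: (iffP andP) => -[hc /eqP bc]. Qed.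

Lemma bounding_subset K K' d c :
  faces K \subset faces K' -> c \in bounding K d -> c \in bounding K' d.
Proof.
move=> sK /boundingP[b hb <-]; apply/boundingP; exists b => //.
exact: chains_subset hb.
Qed.

Lemma cycles_subset K K' d c :
  faces K \subset faces K' -> c \in cycles K d -> c \in cycles K' d.
Proof.
move=> sK /cyclesP[hc bc]; apply/cyclesP; split=> //.
exact: chains_subset hc.
Qed.

(* [hclass K d c] is 0 when c is not a cycle. *)
Definition hclass K d c : homology F K d :=
  \pi_(quotmod (@boundaries F T K d)) (insubd (0 : submodule (cycles K d)) c).

(** A chosen representative. It is linear only up to boundaries ([hrep_lin]), and maps out of
    homology are defined through it. *)
Definition hrep K d (x : homology F K d) : chain F T :=
  val (repr (x : quotmod (@boundaries F T K d))).

Lemma hrep_cycle K d (x : homology F K d) : hrep x \in cycles K d.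
Proof. exact: valP. Qed.

Lemma hclass_eq K d c c' :
    c \in cycles K d -> c' \in cycles K d ->
  hclass K d c = hclass K d c' <-> c - c' \in bounding K d.
Proof.
move=> hc hc'.
have e : val (insubd (0 : submodule (cycles K d)) c
              - insubd (0 : submodule (cycles K d)) c') = c - c'.
  by rewrite raddfB /= !insubdK.
split=> [/pi_quotmodP/asboolP|/boundingP] [b hb eb].
  by apply/boundingP; exists b; rewrite // eb e.
by apply/pi_quotmodP/asboolP; exists b; rewrite // eb e.
Qed.

Lemma hclassK K d (x : homology F K d) : hclass K d (hrep x) = x.
Proof.
by rewrite /hclass /hrep valKd; exact: reprK.
Qed.

Lemma hclass_lin K d a c c' :
    c \in cycles K d -> c' \in cycles K d ->
  hclass K d (a *: c + c') = a *: hclass K d c + hclass K d c'.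
Proof.
move=> hc hc'; rewrite /hclass.
set p : submodule (cycles K d) := insubd _ c; set q := insubd _ c'.
have -> : a *: (\pi_(quotmod (@boundaries F T K d)) p : homology F K d) =
          \pi_(quotmod (@boundaries F T K d)) (a *: p) by rewrite pi_quotmodZ.
rewrite -pi_quotmodD; congr \pi_(_).
by apply/val_inj; rewrite linearP /= !insubdK // rpredD ?rpredZ.
Qed.

Lemma hclass0 K d c : c \in cycles K d -> hclass K d c = 0 <-> c \in bounding K d.
Proof.
move=> hc; rewrite -{2}(subr0 c) -hclass_eq ?rpred0 //.
suff -> : hclass K d 0 = 0 by [].
have := @hclass_lin K d 1 0 0 (rpred0 _) (rpred0 _).
rewrite scaler0 addr0 scale1r => e; apply: (addIr (hclass K d 0)).
by rewrite add0r -e.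
Qed.

Lemma hrep_hclass K d c :
  c \in cycles K d -> hrep (hclass K d c) - c \in bounding K d.
Proof. by move=> hc; apply/hclass_eq; rewrite ?hrep_cycle ?hclassK. Qed.

Lemma hrep_lin K d a (x y : homology F K d) :
  hrep (a *: x + y) - (a *: hrep x + hrep y) \in bounding K d.
Proof.
apply/hclass_eq; rewrite ?rpredD ?rpredZ ?hrep_cycle //.
by rewrite hclass_lin ?hrep_cycle // !hclassK.
Qed.

(** Here r is built from chosen representatives; its failure to be linear consists of boundaries,
    which vanish in homology. *)
Lemma hclass_linear K d (M : lmodType F) (r : M -> chain F T) :
    (forall x, r x \in cycles K d) ->
    (forall a x y, r (a *: x + y) - (a *: r x + r y) \in bounding K d) ->
  linear (fun x => hclass K d (r x)).
Proof.
move=> rc rl a x y; rewrite -hclass_lin //.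
by apply/hclass_eq => //; rewrite rpredD ?rpredZ.
Qed.
End HomologyClasses.

Section DirectSumEvaluation.
Variables (F : pzRingType) (I : finType) (M : I -> lmodType F).

Lemma dsumDE (x y : dsum M) i : (x + y) i = x i + y i.
Proof. exact: ffunE. Qed.
Lemma dsumZE a (x : dsum M) i : (a *: x) i = a *: x i.
Proof. exact: ffunE. Qed.
Lemma dsum0E i : (0 : dsum M) i = 0.
Proof. exact: ffunE. Qed.

Lemma dsum_linear (N : lmodType F) (f : N -> dsum M) :
  (forall i, linear (fun x => f x i)) -> linear f.
Proof.
by move=> fl a x y; apply/ffunP => i; rewrite fl dsumDE dsumZE.
Qed.
End DirectSumEvaluation.
Section LinearRules.
Variables (F : pzRingType) (V : finType).
Local Notation chain := (chain F {set V}).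
Implicit Types (x y : chain) (e : {set V}) (v : V).

Lemma wedgeD e x y : wedge e (x + y) = wedge e x + wedge e y.
Proof. exact: linearD. Qed.
Lemma wedgeN e x : wedge e (- x) = - wedge e x.
Proof. exact: linearN. Qed.
Lemma wedge0 e : wedge e 0 = 0 :> chain.
Proof. exact: linear0. Qed.
Lemma contractD e x y : contract e (x + y) = contract e x + contract e y.
Proof. exact: linearD. Qed.
Lemma contractN e x : contract e (- x) = - contract e x.
Proof. exact: linearN. Qed.
Lemma contract0 e : contract e 0 = 0 :> chain.
Proof. exact: linear0. Qed.
Lemma avoidD v x y : avoid v (x + y) = avoid v x + avoid v y.
Proof. exact: linearD. Qed.
Lemma avoidN v x : avoid v (- x) = - avoid v x.
Proof. exact: linearN. Qed.
Lemma avoid0 v : avoid v 0 = 0 :> chain.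
Proof. exact: linear0. Qed.
Lemma boundaryD x y : boundary (x + y) = boundary x + boundary y.
Proof. exact: linearD. Qed.
Lemma boundaryN x : boundary (- x) = - boundary x.
Proof. exact: linearN. Qed.
Lemma boundary0 : boundary 0 = 0 :> chain.
Proof. exact: linear0. Qed.

Definition chain_linE :=
  (wedgeD, wedgeN, wedge0, contractD, contractN, contract0,
   avoidD, avoidN, avoid0, boundaryD, boundaryN, boundary0).
End LinearRules.

(** * Comparison of A with N and its smaller analogues *)

Section Operators.
Variables (F : pzRingType) (n : nat).
Hypothesis n_ge5 : (5 <= n)%N.
Local Notation V := 'I_n.+1.
Local Notation chain := (chain F {set V}).
Implicit Types (s t v : V) (k : Pindex n) (e : {set V}) (x y c : chain).
Local Notation v1 := (inord 1 : V).
Local Notation v2 := (inord 2 : V).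
Local Notation v3 := (inord 3 : V).
Local Notation e13 := (edge v1 v3).
Local Notation e23 := (edge v2 v3).

(* [phiN] and [phi k] embed the chains of M[[4,n]] and of M[[4,n] \ {s,t}], for
   k = (s, t), into those of A. The last term of [phi k] cancels the boundary
   (13 - 23) ^ x of the first three when x is a cycle. *)
Definition phiN x : chain := wedge e13 x - wedge e23 x.

Definition phi k x : chain :=
  wedge (edge v1 (val k).1) (wedge (edge v2 (val k).2) x)
  + wedge e23 (wedge (edge v1 (val k).1) x)
  - wedge e13 (wedge (edge v2 (val k).2) x)
  + phiN (wedge (edge (val k).1 (val k).2) x).

(* [psiN] and [psi k] give a left inverse. On A the contractions at 1 alone do not
   commute with the boundary: the coefficients of 23 and of the 1s have to be added,
   and the second sum in [psiN] corrects the defect caused by the faces 1s, 2t. *)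
Definition psi k c : chain :=
  contract (edge v2 (val k).2) (contract (edge v1 (val k).1) c).

Definition psiN c : chain :=
  - (avoid v1 (avoid v2 (contract e23 c +
       \sum_(s in itv n 4 n) contract (edge v1 s) c)) +
     \sum_k wedge (edge (val k).1 (val k).2) (psi k c)).

(* The matching described at the top: add 13 to faces free at 1 and 3, add 23 to
   faces containing some 1s and free at 2 and 3. *)
Definition homotopy c : chain :=
  wedge e13 (avoid v1 (avoid v3 c)) +
  wedge e23 (avoid v2 (avoid v3 (c - avoid v1 c))).

(** The two copies of x that come from removing 13 and 23 cancel; the sign reflects the odd degree
    of [phiN]. *)
Lemma boundary_phiN x : boundary (phiN x) = - phiN (boundary x).
Proof. rewrite /phiN !chain_linE !boundary_wedge; zmod_solve. Qed.

(** Apart from the terms in boundary x, the first three summands of [phi] contribute 1s ^ x and 2t ^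
    x with cancelling signs and leave [phiN x]; the boundary of the last summand contributes -
    [phiN x]. *)
Lemma boundary_phi k x : boundary (phi k x) = phi k (boundary x).
Proof.
rewrite /phi boundaryD boundary_phiN /phiN !(chain_linE, boundary_wedge).
by zmod_solve.
Qed.

Lemma boundary_psi k c : boundary (psi k c) = psi k (boundary c).
Proof. by rewrite /psi !(boundary_contract, contractN) opprK. Qed.

Fact phiN_is_linear : linear phiN.
Proof.
by move=> a x y; rewrite /phiN !linearP /= !(scalerDr, scalerN); zmod_solve.
Qed.
HB.instance Definition _ :=
  GRing.isLinear.Build F chain chain *:%R phiN phiN_is_linear.

Fact phi_is_linear k : linear (phi k).
Proof.
move=> a x y; rewrite /phi.
by rewrite !linearP /= !(scalerDr, scalerN) /=; zmod_solve.
Qed.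
HB.instance Definition _ k :=
  GRing.isLinear.Build F chain chain *:%R (phi k) (phi_is_linear k).

Fact psi_is_linear k : linear (psi k).
Proof. by move=> a x y; rewrite /psi !linearP. Qed.
HB.instance Definition _ k :=
  GRing.isLinear.Build F chain chain *:%R (psi k) (psi_is_linear k).

Fact psiN_is_linear : linear psiN.
Proof.
move=> a x y; rewrite /psiN.
under eq_bigr do rewrite linearP.
under [\sum_k _]eq_bigr do rewrite !linearP.
rewrite !big_split -!scaler_sumr !linearP /= !linearD /=.
rewrite !(linearZ, scalerDr, scalerN) /=.
by zmod_solve.
Qed.
HB.instance Definition _ :=
  GRing.isLinear.Build F chain chain *:%R psiN psiN_is_linear.

Fact homotopy_is_linear : linear homotopy.
Proof.
move=> a x y; rewrite /homotopy.
by rewrite !(linearP, linearD, linearN) /= !(scalerDr, scalerN) /=; zmod_solve.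
Qed.
HB.instance Definition _ :=
  GRing.isLinear.Build F chain chain *:%R homotopy homotopy_is_linear.

(** * The special vertices 1, 2, 3 and chains without edges at them *)

Lemma inord_eq a b :
  (a <= n)%N -> (b <= n)%N -> ((inord a : V) == inord b) = (a == b).
Proof. by move=> an bn; rewrite -val_eqE /= !inordK. Qed.

Lemma itv4_inord a s : (a <= 3)%N -> s \in itv n 4 n -> (s == inord a) = false.
Proof.
move=> a3; rewrite inE -val_eqE /= inordK; last by lia.
by case/andP=> s4 _; apply/eqP => es; move: s4; rewrite es ltnNge a3.
Qed.

Lemma Pindex_itv4 k :
  [/\ (val k).1 \in itv n 4 n, (val k).2 \in itv n 4 n & (val k).1 != (val k).2].
Proof. by case: k => -[s t] /= /and3P[]. Qed.

Lemma edge_inj v s t : edge v s = edge v t -> v != s -> s = t.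
Proof.
move=> /setP/(_ s); rewrite !inE eqxx orbT eq_sym => /esym/orP[/eqP->|/eqP//].
by rewrite eqxx.
Qed.

Lemma v1_neq_v2 : v1 != v2. Proof. by rewrite inord_eq //; lia. Qed.
Lemma v1_neq_v3 : v1 != v3. Proof. by rewrite inord_eq //; lia. Qed.
Lemma v2_neq_v3 : v2 != v3. Proof. by rewrite inord_eq //; lia. Qed.

(** Phrased as invariance under the three projections so that it can be used by rewriting. Such
    chains are the coefficients left after splitting off the edges at 1 and 2. *)
Definition clean x :=
  [/\ avoid v1 x = x, avoid v2 x = x & avoid v3 x = x].

Lemma clean_boundary x : clean x -> clean (boundary x).
Proof. by case=> *; split; apply: avoid_boundary. Qed.

Lemma clean_wedge s t x :
  s \in itv n 4 n -> t \in itv n 4 n -> clean x -> clean (wedge (edge s t) x).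
Proof.
move=> s4 t4 [x1 x2 x3]; split; rewrite avoid_wedge ?x1 ?x2 ?x3 //;
  by rewrite !inE ![inord _ == _]eq_sym !itv4_inord.
Qed.

Lemma mem_edgel v w : v \in edge v w. Proof. by rewrite !inE eqxx. Qed.
Lemma mem_edger v w : w \in edge v w. Proof. by rewrite !inE eqxx orbT. Qed.

Lemma small_itv4 a s : (a <= 3)%N -> s \in itv n 4 n -> (inord a == s) = false.
Proof. by move=> a3 s4; rewrite eq_sym itv4_inord. Qed.

Lemma avoid1_wedge13 x : avoid v1 (wedge e13 x) = 0.
Proof. by rewrite avoid_wedge0 ?mem_edgel. Qed.
Lemma avoid3_wedge13 x : avoid v3 (wedge e13 x) = 0.
Proof. by rewrite avoid_wedge0 ?mem_edger. Qed.
Lemma avoid2_wedge13 x : avoid v2 (wedge e13 x) = wedge e13 (avoid v2 x).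
Proof. by rewrite avoid_wedge // !inE !inord_eq //; lia. Qed.
Lemma avoid2_wedge23 x : avoid v2 (wedge e23 x) = 0.
Proof. by rewrite avoid_wedge0 ?mem_edgel. Qed.
Lemma avoid3_wedge23 x : avoid v3 (wedge e23 x) = 0.
Proof. by rewrite avoid_wedge0 ?mem_edger. Qed.
Lemma avoid1_wedge23 x : avoid v1 (wedge e23 x) = wedge e23 (avoid v1 x).
Proof. by rewrite avoid_wedge // !inE !inord_eq //; lia. Qed.
Lemma avoid1_wedge1 s x : avoid v1 (wedge (edge v1 s) x) = 0.
Proof. by rewrite avoid_wedge0 ?mem_edgel. Qed.
Lemma avoid2_wedge2 s x : avoid v2 (wedge (edge v2 s) x) = 0.
Proof. by rewrite avoid_wedge0 ?mem_edgel. Qed.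
Lemma avoid2_wedge1 s x :
  s \in itv n 4 n -> avoid v2 (wedge (edge v1 s) x) = wedge (edge v1 s) (avoid v2 x).
Proof. by move=> s4; rewrite avoid_wedge // !inE inord_eq ?small_itv4 //; lia. Qed.
Lemma avoid3_wedge1 s x :
  s \in itv n 4 n -> avoid v3 (wedge (edge v1 s) x) = wedge (edge v1 s) (avoid v3 x).
Proof. by move=> s4; rewrite avoid_wedge // !inE inord_eq ?small_itv4 //; lia. Qed.
Lemma avoid1_wedge2 s x :
  s \in itv n 4 n -> avoid v1 (wedge (edge v2 s) x) = wedge (edge v2 s) (avoid v1 x).
Proof. by move=> s4; rewrite avoid_wedge // !inE inord_eq ?small_itv4 //; lia. Qed.
Lemma avoid3_wedge2 s x :
  s \in itv n 4 n -> avoid v3 (wedge (edge v2 s) x) = wedge (edge v2 s) (avoid v3 x).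
Proof. by move=> s4; rewrite avoid_wedge // !inE inord_eq ?small_itv4 //; lia. Qed.

Definition avoid_wedgeE :=
  (avoid1_wedge13, avoid2_wedge13, avoid3_wedge13, avoid1_wedge23,
   avoid2_wedge23, avoid3_wedge23, avoid1_wedge1, avoid2_wedge1, avoid3_wedge1,
   avoid1_wedge2, avoid2_wedge2, avoid3_wedge2).

Lemma contract1_wedge2 s t x :
  t \in itv n 4 n -> avoid v1 x = x -> contract (edge v1 s) (wedge (edge v2 t) x) = 0.
Proof.
move=> t4 x1; apply: (@contract_avoided _ _ v1); rewrite ?mem_edgel //.
by rewrite avoid1_wedge2 ?x1.
Qed.

Lemma contract1_wedge23 s x :
  avoid v1 x = x -> contract (edge v1 s) (wedge e23 x) = 0.
Proof.
move=> x1; apply: (@contract_avoided _ _ v1); rewrite ?mem_edgel //.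
by rewrite avoid1_wedge23 ?x1.
Qed.

Lemma edge_neq v s t : v != s -> s != t -> edge v s != edge v t.
Proof. by move=> nvs; apply: contra_neq => /edge_inj; apply. Qed.

Lemma contract_same v s x :
  avoid v x = x -> contract (edge v s) (wedge (edge v s) x) = x.
Proof.
by move=> xv; rewrite contract_wedge (contract_avoided xv) ?mem_edgel // wedge0 subr0.
Qed.

Lemma contract_other v s t x :
    v != s -> s != t ->
  contract (edge v s) (wedge (edge v t) x) = - wedge (edge v t) (contract (edge v s) x).
Proof. by move=> nvs nst; rewrite contract_wedgeN // edge_neq. Qed.

Lemma sum_contract1 s x :
    s \in itv n 4 n -> avoid v1 x = x ->
  \sum_(s' in itv n 4 n) contract (edge v1 s') (wedge (edge v1 s) x) = x.
Proof.
move=> s4 x1; rewrite (bigD1 s) //= contract_same // big1 ?addr0 // => s' /andP[s'4 ns].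
by rewrite contract_other ?small_itv4 // (contract_avoided x1) ?mem_edgel // wedge0 oppr0.
Qed.

Lemma contract1_wedge13 s x :
  s \in itv n 4 n -> avoid v1 x = x -> contract (edge v1 s) (wedge e13 x) = 0.
Proof.
move=> s4 x1; rewrite contract_other ?small_itv4 ?itv4_inord //.
by rewrite (contract_avoided x1) ?mem_edgel // wedge0 oppr0.
Qed.

Lemma contract2_wedge23 t x :
  t \in itv n 4 n -> avoid v2 x = x -> contract (edge v2 t) (wedge e23 x) = 0.
Proof.
move=> s4 x1; rewrite contract_other ?small_itv4 ?itv4_inord //.
by rewrite (contract_avoided x1) ?mem_edgel // wedge0 oppr0.
Qed.

(** Contraction at 23 commutes with [avoid v1] but not with [avoid v2], contraction at 1s with
    [avoid v2] but not with [avoid v1]. Each projection that commutes is moved inside, where it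
    kills most joins at once. *)
Lemma psiNE c :
  psiN c = - (avoid v2 (contract e23 (avoid v1 c)) +
              \sum_(s in itv n 4 n) avoid v1 (contract (edge v1 s) (avoid v2 c)) +
              \sum_k wedge (edge (val k).1 (val k).2) (psi k c)).
Proof.
congr (- (_ + _)); rewrite !avoidD avoidC avoid_contract; last first.
  by rewrite !inE !inord_eq //; lia.
congr (_ + _); rewrite !linear_sum /=; apply: eq_bigr => s s4.
by rewrite avoid_contract // !inE inord_eq ?small_itv4 //; lia.
Qed.

Lemma contract1_wedge1 s' s x :
    s' \in itv n 4 n -> avoid v1 x = x ->
  contract (edge v1 s') (wedge (edge v1 s) x) = if s' == s then x else 0.
Proof.
move=> s'4 x1; case: eqP => [->|/eqP ns]; first by rewrite contract_same.
by rewrite contract_other ?small_itv4 // (contract_avoided x1) ?mem_edgel // wedge0 oppr0.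
Qed.

Lemma contract2_wedge2 t' t x :
    t' \in itv n 4 n -> avoid v2 x = x ->
  contract (edge v2 t') (wedge (edge v2 t) x) = if t' == t then x else 0.
Proof.
move=> s'4 x1; case: eqP => [->|/eqP ns]; first by rewrite contract_same.
by rewrite contract_other ?small_itv4 // (contract_avoided x1) ?mem_edgel // wedge0 oppr0.
Qed.

(** * Values of the inverse maps and of the homotopy on the eight kinds of joins *)

Section PsiValues.
Variables (x : chain) (s t : V) (k : Pindex n).
Hypotheses (cx : clean x) (s4 : s \in itv n 4 n) (t4 : t \in itv n 4 n).

Let x1 : avoid v1 x = x. Proof. by case: cx. Qed.
Let x2 : avoid v2 x = x. Proof. by case: cx. Qed.
Let x3 : avoid v3 x = x. Proof. by case: cx. Qed.
Let c1 w : contract (edge v1 w) x = 0.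
Proof. by rewrite (contract_avoided x1) ?mem_edgel. Qed.
Let c2 w : contract (edge v2 w) x = 0.
Proof. by rewrite (contract_avoided x2) ?mem_edgel. Qed.
Let k1 : (val k).1 \in itv n 4 n. Proof. by case: (Pindex_itv4 k). Qed.
Let k2 : (val k).2 \in itv n 4 n. Proof. by case: (Pindex_itv4 k). Qed.

Lemma psi_clean : psi k x = 0.
Proof. by rewrite /psi c1 contract0. Qed.
Lemma psi_wedge13 : psi k (wedge e13 x) = 0.
Proof. by rewrite /psi contract1_wedge13 // contract0. Qed.
Lemma psi_wedge23 : psi k (wedge e23 x) = 0.
Proof. by rewrite /psi contract1_wedge23 // contract0. Qed.
Lemma psi_wedge1 : psi k (wedge (edge v1 s) x) = 0.
Proof. by rewrite /psi contract1_wedge1 //; case: eqP; rewrite ?c2 ?contract0. Qed.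
Lemma psi_wedge2 : psi k (wedge (edge v2 t) x) = 0.
Proof. by rewrite /psi contract1_wedge2 // contract0. Qed.
Lemma psi_wedge13_2 : psi k (wedge e13 (wedge (edge v2 t) x)) = 0.
Proof. by rewrite /psi contract1_wedge13 ?contract0 // avoid1_wedge2 ?x1. Qed.
Lemma psi_wedge1_23 : psi k (wedge (edge v1 s) (wedge e23 x)) = 0.
Proof.
rewrite /psi contract1_wedge1 ?avoid1_wedge23 ?x1 //.
by case: eqP; rewrite ?contract2_wedge23 ?contract0.
Qed.
Lemma psi_wedge1_2 k' :
  psi k (wedge (edge v1 (val k').1) (wedge (edge v2 (val k').2) x)) =
    if k == k' then x else 0.
Proof.
have [_ k'2 _] := Pindex_itv4 k'.
rewrite /psi contract1_wedge1 ?avoid1_wedge2 ?x1 //.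
have -> : (k == k') = ((val k).1 == (val k').1) && ((val k).2 == (val k').2).
  by rewrite -val_eqE; case: (val k) (val k') => a b [a' b']; rewrite xpair_eqE.
case: eqP => [_|] /=; last by rewrite contract0.
by rewrite contract2_wedge2.
Qed.
End PsiValues.

Section PsiNAndHomotopyValues.
Variables (x : chain) (s t : V).
Hypotheses (cx : clean x) (s4 : s \in itv n 4 n) (t4 : t \in itv n 4 n).

Let x1 : avoid v1 x = x. Proof. by case: cx. Qed.
Let x2 : avoid v2 x = x. Proof. by case: cx. Qed.
Let x3 : avoid v3 x = x. Proof. by case: cx. Qed.
Let c1 w : contract (edge v1 w) x = 0.
Proof. by rewrite (contract_avoided x1) ?mem_edgel. Qed.
Let c2 w : contract (edge v2 w) x = 0.
Proof. by rewrite (contract_avoided x2) ?mem_edgel. Qed.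

Lemma psiN_aux a b c y :
    avoid v2 (contract e23 (avoid v1 c)) = a ->
    \sum_(w in itv n 4 n) avoid v1 (contract (edge v1 w) (avoid v2 c)) = b ->
    \sum_k wedge (edge (val k).1 (val k).2) (psi k c) = y ->
  psiN c = - (a + b + y).
Proof. by move=> <- <- <-; exact: psiNE. Qed.

Let sum0 c : avoid v2 c = 0 ->
  \sum_(w in itv n 4 n) avoid v1 (contract (edge v1 w) (avoid v2 c)) = 0.
Proof. by move=> ->; apply: big1 => w _; rewrite contract0 avoid0. Qed.
Let sumk0 c : (forall k, psi k c = 0) ->
  \sum_k wedge (edge (val k).1 (val k).2) (psi k c) = 0.
Proof. by move=> h; apply: big1 => k _; rewrite h wedge0. Qed.

Lemma psiN_clean : psiN x = 0.
Proof.
rewrite (@psiN_aux 0 0 _ 0) ?addr0 ?oppr0 //.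
- by rewrite x1 c2 avoid0.
- by apply: big1 => w _; rewrite x2 c1 avoid0.
- by apply: sumk0 => k; apply: psi_clean.
Qed.
Lemma psiN_wedge13 : psiN (wedge e13 x) = 0.
Proof.
rewrite (@psiN_aux 0 0 _ 0) ?addr0 ?oppr0 //.
- by rewrite avoid_wedgeE contract0 avoid0.
- by apply: big1 => w w4; rewrite avoid_wedgeE x2 contract1_wedge13 // avoid0.
- by apply: sumk0 => k; apply: psi_wedge13.
Qed.
Lemma psiN_wedge23 : psiN (wedge e23 x) = - x.
Proof.
rewrite (@psiN_aux x 0 _ 0) ?addr0 //.
- by rewrite avoid_wedgeE x1 contract_same.
- by apply: sum0; rewrite avoid_wedgeE.
- by apply: sumk0 => k; apply: psi_wedge23.
Qed.
(** The value agrees with that on 23 ^ x: up to terms in boundary x, the boundary of 23 ^ 1s ^ x is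
    1s ^ x - 23 ^ x. *)
Lemma psiN_wedge1 : psiN (wedge (edge v1 s) x) = - x.
Proof.
rewrite (@psiN_aux 0 x _ 0) ?add0r ?addr0 //.
- by rewrite avoid_wedgeE contract0 avoid0.
- by rewrite avoid2_wedge1 // x2 -linear_sum /= sum_contract1.
- by apply: sumk0 => k; apply: psi_wedge1.
Qed.
Lemma psiN_wedge2 : psiN (wedge (edge v2 t) x) = 0.
Proof.
rewrite (@psiN_aux 0 0 _ 0) ?addr0 ?oppr0 //.
- rewrite avoid_wedgeE // x1 contract_other ?v2_neq_v3 ?small_itv4 //.
  by rewrite c2 wedge0 oppr0 avoid0.
- by apply: sum0; rewrite avoid_wedgeE.
- by apply: sumk0 => k; apply: psi_wedge2.
Qed.
Lemma psiN_wedge13_2 : psiN (wedge e13 (wedge (edge v2 t) x)) = 0.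
Proof.
rewrite (@psiN_aux 0 0 _ 0) ?addr0 ?oppr0 //.
- by rewrite avoid_wedgeE contract0 avoid0.
- by apply: sum0; rewrite !avoid_wedgeE wedge0.
- by apply: sumk0 => k; apply: psi_wedge13_2.
Qed.
Lemma psiN_wedge1_23 : psiN (wedge (edge v1 s) (wedge e23 x)) = 0.
Proof.
rewrite (@psiN_aux 0 0 _ 0) ?addr0 ?oppr0 //.
- by rewrite avoid_wedgeE contract0 avoid0.
- by apply: sum0; rewrite avoid2_wedge1 // avoid_wedgeE wedge0.
- by apply: sumk0 => k; apply: psi_wedge1_23.
Qed.
(** Only the correcting sum of [psiN] contributes here. *)
Lemma psiN_wedge1_2 k :
  psiN (wedge (edge v1 (val k).1) (wedge (edge v2 (val k).2) x)) =
    - wedge (edge (val k).1 (val k).2) x.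
Proof.
have [k1 k2 _] := Pindex_itv4 k.
rewrite (@psiN_aux 0 0 _ (wedge (edge (val k).1 (val k).2) x)) ?add0r //.
- by rewrite avoid_wedgeE contract0 avoid0.
- by apply: sum0; rewrite avoid2_wedge1 // avoid_wedgeE wedge0.
- rewrite (bigD1 k) //= psi_wedge1_2 // eqxx big1 ?addr0 // => k' nk.
  by rewrite psi_wedge1_2 // (negPf nk) wedge0.
Qed.

Lemma homotopy_clean : homotopy x = wedge e13 x.
Proof. by rewrite /homotopy x3 x1 subrr !avoid0 wedge0 addr0. Qed.
Lemma homotopy_wedge13 : homotopy (wedge e13 x) = 0.
Proof.
by rewrite /homotopy avoid3_wedge13 avoid1_wedge13 subr0 avoid3_wedge13 !chain_linE addr0.
Qed.
Lemma homotopy_wedge23 : homotopy (wedge e23 x) = 0.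
Proof.
by rewrite /homotopy avoid3_wedge23 avoid1_wedge23 x1 subrr !chain_linE addr0.
Qed.
Lemma homotopy_wedge1 : homotopy (wedge (edge v1 s) x) = wedge e23 (wedge (edge v1 s) x).
Proof.
by rewrite /homotopy avoid3_wedge1 // avoid1_wedge1 avoid1_wedge1 subr0 avoid3_wedge1 //
  avoid2_wedge1 // x3 x2 wedge0 add0r.
Qed.
Lemma homotopy_wedge2 : homotopy (wedge (edge v2 t) x) = wedge e13 (wedge (edge v2 t) x).
Proof.
by rewrite /homotopy avoid3_wedge2 // avoid1_wedge2 // avoid1_wedge2 // x3 x1 subrr
  !chain_linE addr0.
Qed.
Lemma homotopy_wedge13_2 : homotopy (wedge e13 (wedge (edge v2 t) x)) = 0.
Proof.
by rewrite /homotopy avoid3_wedge13 avoid1_wedge13 subr0 avoid3_wedge13 !chain_linE addr0.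
Qed.
Lemma homotopy_wedge1_23 : homotopy (wedge (edge v1 s) (wedge e23 x)) = 0.
Proof.
by rewrite /homotopy avoid3_wedge1 // avoid1_wedge1 avoid1_wedge1 subr0 avoid3_wedge1 //
  avoid3_wedge23 !chain_linE addr0.
Qed.
Lemma homotopy_wedge1_2 : homotopy (wedge (edge v1 s) (wedge (edge v2 t) x)) = 0.
Proof.
by rewrite /homotopy avoid3_wedge1 // avoid1_wedge1 avoid1_wedge1 subr0 avoid3_wedge1 //
  avoid2_wedge1 // avoid3_wedge2 // avoid2_wedge2 !chain_linE addr0.
Qed.
End PsiNAndHomotopyValues.

(* [admissible S] is M[S] without these edges; for S = [1,n] it is A. *)
Definition forbidden : {set {set V}} :=
  edge12 n |: [set edge v3 u | u in itv n 4 n].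
Local Notation admissible S := (matchings S forbidden).
Implicit Types (S : {set V}) (d : int).

Lemma edge_through S e v :
  e \subset S -> #|e| = 2 -> v \in e -> exists w, [/\ w \in S, w != v & e = edge v w].
Proof.
move=> eS /eqP/cards2P[a [b [nab ee]]].
have [aS bS] : a \in S /\ b \in S.
  by split; apply: (subsetP eS); rewrite ee !inE eqxx ?orbT.
rewrite ee !inE => /orP[] /eqP->; first by exists b; rewrite eq_sym.
by exists a; split=> //; rewrite /edge setUC.
Qed.

Lemma itv1_cases w :
  w \in itv n 1 n -> [\/ w = v1, w = v2, w = v3 | w \in itv n 4 n].
Proof.
rewrite !inE => /andP[w1 _]; have wn : (w <= n)%N by rewrite -ltnS ltn_ord.
have [w4|w3] := leqP 4 w; first by constructor 4.
by case: (posnP (w - 1)) => ?; [constructor 1 | case: (posnP (w - 2)) => ?;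
  [constructor 2 | constructor 3]]; apply/val_inj; rewrite /= inordK; lia.
Qed.

Lemma chains_avoid S v d c :
  c \in chains (admissible S) d -> avoid v c \in chains (admissible (S :\ v)) d.
Proof.
apply: chains_restrict => s sS nvs; apply: matchings_cover (sS) _ _ => //.
by rewrite subsetD1 nvs andbT; move: sS; rewrite in_matchings is_matchingE => /andP[/and3P[]].
Qed.

Lemma avoid_notin S X v d c :
  v \notin S -> c \in chains (matchings S X) d -> avoid v c = c.
Proof.
move=> nvS /chainsP hc; apply/ffunP => s; rewrite ffunE; case: ifPn => //.
rewrite negbK => vs; rewrite hc //; apply: contra nvS => /andP[].
rewrite in_matchings is_matchingE => /andP[/and3P[/subsetP sS _ _] _] _.
exact: sS.
Qed.

Lemma contract_notsub S X e d c :
  ~~ (e \subset S) -> c \in chains (matchings S X) d -> contract e c = 0.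
Proof.
move=> neS /chainsP hc; apply/ffunP => s; rewrite !ffunE; case: ifP => // _.
rewrite hc ?mulr0 //; apply: contra neS => /andP[sK _].
by have [] := matchings_edge sK (setU11 _ _).
Qed.

Lemma chains_contract_matchings S X e d c :
  c \in chains (matchings S X) (d + 1) ->
  contract e c \in chains (matchings (S :\: e) X) d.
Proof. by apply: chains_contract => // s sS es; apply: matchings_setD1. Qed.

(** The vertex 3 may lie in S, but without 1 and 2 every edge of S at 3 is some 3u with u >= 4,
    which is forbidden. *)
Lemma clean_chain S d x :
    S \subset itv n 1 n -> v1 \notin S -> v2 \notin S ->
  x \in chains (admissible S) d -> clean x.
Proof.
move=> /subsetP Sn nS1 nS2 hx; split; try exact: avoid_notin hx.
apply/ffunP => s; rewrite ffunE; case: ifPn => //; rewrite negbK.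
case/bigcupP => e es ve; move/chainsP: hx => -> //; apply/negP => /andP[sK _].
have [eS e2 /negP[]] := matchings_edge sK es.
have [w [wS nw3 ee]] := edge_through eS e2 ve.
case: (itv1_cases (Sn _ wS)) => [w1|w2|w3|w4].
- by rewrite w1 (negPf nS1) in wS.
- by rewrite w2 (negPf nS2) in wS.
- by rewrite w3 eqxx in nw3.
- by rewrite ee inE; apply/orP; right; apply: imset_f.
Qed.

(** Since 12 is forbidden, the edges at 1 or 2 that can occur are the one to 3 and those to
    [4,n]. *)
Lemma chains_split12 S v d c :
    S \subset itv n 1 n -> v = v1 \/ v = v2 ->
    c \in chains (admissible S) d ->
  c = avoid v c + (wedge (edge v v3) (contract (edge v v3) c) +
        \sum_(s in itv n 4 n) wedge (edge v s) (contract (edge v s) c)).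
Proof.
move=> Sn v12; have nv3 : v != v3 by case: v12 => ->; rewrite inord_eq //; lia.
have nv4 w : w \in itv n 4 n -> v != w.
  by move=> w4; case: v12 => ->; rewrite small_itv4.
move/(@chains_split _ _ _ _ v (edge v v3 :: [seq edge v s | s <- enum (itv n 4 n)])).
rewrite big_cons big_map big_enum; apply.
- rewrite /= map_inj_in_uniq ?enum_uniq ?andbT.
    apply/negP => /mapP[s]; rewrite mem_enum => s4 /edge_inj/(_ nv3) s3.
    by move: (itv4_inord (leqnn 3) s4); rewrite -s3 eqxx.
  by move=> a b; rewrite !mem_enum => a4 _ /edge_inj; apply; apply: nv4.
- by move=> e; rewrite inE => /orP[/eqP->|/mapP[s _ ->]]; rewrite mem_edgel.
move=> s e sK es ve; have [eS e2 nX] := matchings_edge sK es.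
have [w [wS nwv ee]] := edge_through eS e2 ve; rewrite ee in nX *.
have e12 : edge v1 v2 \in forbidden by rewrite setU11.
have := itv1_cases (subsetP Sn _ wS); case=> [w1|w2|->|w4].
- case: v12 => ev; move: nwv nX; rewrite w1 ev ?eqxx // => _.
  by rewrite [edge v2 v1]setUC e12.
- by case: v12 => ev; move: nwv nX; rewrite w2 ev ?eqxx // e12.
- by rewrite mem_head.
- by rewrite inE map_f ?orbT // mem_enum.
Qed.

Lemma clean_avoid2 (B : {set V}) d x :
    v1 \in B -> x \in chains (admissible (itv n 1 n :\: B)) d ->
  clean (avoid v2 x).
Proof.
move=> v1B /(chains_avoid v2); apply: clean_chain.
- by apply: subset_trans (subsetDl _ _) (subsetDl _ _).
- by rewrite !in_setD v1B /= andbF.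
- by rewrite !inE eqxx.
Qed.

Lemma clean_contract2 (B : {set V}) w d x :
    v1 \in B -> x \in chains (admissible (itv n 1 n :\: B)) (d + 1) ->
  clean (contract (edge v2 w) x).
Proof.
move=> v1B /(chains_contract_matchings (edge v2 w)); apply: clean_chain.
- by apply: subset_trans (subsetDl _ _) (subsetDl _ _).
- by rewrite !in_setD v1B /= andbF.
- by rewrite !inE eqxx.
Qed.

(* Splitting a chain by the edges at 1 and then at 2 leaves eight kinds of terms. *)
Lemma admissible_ind (L : {linear chain -> chain}) d c :
    (forall x, clean x -> L x = 0) ->
    (forall x, clean x -> L (wedge e13 x) = 0) ->
    (forall x, clean x -> L (wedge e23 x) = 0) ->
    (forall s x, s \in itv n 4 n -> clean x -> L (wedge (edge v1 s) x) = 0) ->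
    (forall t x, t \in itv n 4 n -> clean x -> L (wedge (edge v2 t) x) = 0) ->
    (forall t x, t \in itv n 4 n -> clean x ->
       L (wedge e13 (wedge (edge v2 t) x)) = 0) ->
    (forall s x, s \in itv n 4 n -> clean x ->
       L (wedge (edge v1 s) (wedge e23 x)) = 0) ->
    (forall k x, clean x ->
       L (wedge (edge v1 (val k).1) (wedge (edge v2 (val k).2) x)) = 0) ->
  c \in chains (admissible (itv n 1 n)) d -> L c = 0.
Proof.
move=> L0 L13 L23 L1 L2 L13_2 L1_23 L1_2.
(* The degree is put in the form d - 2 + 1 + 1, ready for two successive contractions. *)
rewrite -(subrK 1 d) -(subrK 1 (d - 1)) => hc.
rewrite (chains_split12 (subxx _) (or_introl erefl) hc) !linearD linear_sum /=.
rewrite [X in _ + (_ + X)]big1 ?addr0 => [|s s4]; last first.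
  have := chains_contract_matchings (edge v1 s) hc; set y := contract _ c => hy.
  rewrite (chains_split12 (subsetDl _ _) (or_intror erefl) hy).
  rewrite !wedgeD !linear_sum /= !linearD linear_sum /=.
  have v1s := mem_edgel v1 s.
  rewrite (L1 _ _ s4 (clean_avoid2 v1s hy)).
  rewrite (L1_23 _ _ s4 (clean_contract2 _ v1s hy)) !add0r.
  (* For s = t the term vanishes: once 1s is contracted, the vertex s is gone and 2s cannot
     occur. *)
  apply: big1 => t t4; have [est|nst] := eqVneq s t.
    rewrite (contract_notsub _ hy) ?wedge0 ?linear0 //.
    by apply/negP => /subsetP/(_ t); rewrite !inE est eqxx !orbT /= => /(_ isT).
  pose k : Pindex n := Sub (s, t) (introT and3P (And3 s4 t4 nst)).
  exact: (L1_2 k _ (clean_contract2 _ v1s hy)).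
have := chains_contract_matchings e13 hc; set y := contract _ c => hy.
have v13 := mem_edgel v1 v3.
rewrite (chains_split12 (subsetDl _ _) (or_intror erefl) hy).
rewrite !wedgeD !linear_sum /= !linearD linear_sum /=.
(* No 23 after 13, since the vertex 3 is already used. *)
rewrite (contract_notsub _ hy) ?wedge0 ?linear0 ?add0r; last first.
  by apply/negP => /subsetP/(_ v3); rewrite !inE !eqxx !orbT /= => /(_ isT).
rewrite (L13 _ (clean_avoid2 v13 hy)) add0r big1 ?addr0 => [|t t4]; last first.
  exact: (L13_2 _ _ t4 (clean_contract2 _ v13 hy)).
have := chains_avoid v1 hc; set z := avoid _ c => hz.
have v11 : v1 \in [set v1] by rewrite inE.
rewrite (chains_split12 (subsetDl _ _) (or_intror erefl) hz).
rewrite !linearD linear_sum /= (L0 _ (clean_avoid2 v11 hz)) add0r.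
rewrite (L23 _ (clean_contract2 _ v11 hz)) add0r.
by apply: big1 => t t4; exact: (L2 _ _ t4 (clean_contract2 _ v11 hz)).
Qed.

Lemma psiND x y : psiN (x + y) = psiN x + psiN y. Proof. exact: linearD. Qed.
Lemma psiNN x : psiN (- x) = - psiN x. Proof. exact: linearN. Qed.
Lemma psiD k x y : psi k (x + y) = psi k x + psi k y. Proof. exact: linearD. Qed.
Lemma psiNeg k x : psi k (- x) = - psi k x. Proof. exact: linearN. Qed.
Lemma homotopyD x y : homotopy (x + y) = homotopy x + homotopy y. Proof. exact: linearD. Qed.
Lemma homotopyN x : homotopy (- x) = - homotopy x. Proof. exact: linearN. Qed.

(** The decisive case is 1s ^ 2t ^ x: its boundary contains - 1s ^ x, on which [psiN] is x, and this
    is balanced by the boundary of the correction - st ^ x. *)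
Lemma boundary_psiN d c :
  c \in chains (admissible (itv n 1 n)) d ->
  boundary (psiN c) = - psiN (boundary c).
Proof.
(* The identity is recast as the vanishing of one linear operator, the form required by
   [admissible_ind]. *)
pose L : {linear chain -> chain} := (@boundary F _ \o psiN) \+ (psiN \o @boundary F _).
move=> hc; apply/eqP; rewrite -addr_eq0; apply/eqP.
apply: (@admissible_ind L _ _ _ _ _ _ _ _ _ _ hc)
  => {hc c} [x|x|x|s x s4|t x t4|t x t4|s x s4|k x] cx;
  have cdx := clean_boundary cx; rewrite /L /=.
- by rewrite (psiN_clean cx) (psiN_clean cdx) boundary0 addr0.
- rewrite boundary_wedge psiND psiNN (psiN_clean cx) (psiN_wedge13 cx).
  rewrite (psiN_wedge13 cdx) boundary0; zmod_solve.
- rewrite boundary_wedge psiND psiNN (psiN_clean cx) (psiN_wedge23 cx).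
  by rewrite (psiN_wedge23 cdx) boundaryN; zmod_solve.
- rewrite boundary_wedge psiND psiNN (psiN_clean cx) (psiN_wedge1 cx s4).
  by rewrite (psiN_wedge1 cdx s4) boundaryN; zmod_solve.
- rewrite boundary_wedge psiND psiNN (psiN_clean cx) (psiN_wedge2 cx t4).
  rewrite (psiN_wedge2 cdx t4) boundary0; zmod_solve.
- rewrite !(boundary_wedge, wedgeD, wedgeN) !(psiND, psiNN).
  rewrite (psiN_wedge2 cx t4) (psiN_wedge13_2 cx t4) (psiN_wedge13_2 cdx t4).
  by rewrite (psiN_wedge13 cx) boundary0; zmod_solve.
- rewrite !(boundary_wedge, wedgeD, wedgeN) !(psiND, psiNN).
  rewrite (psiN_wedge23 cx) (psiN_wedge1_23 cx s4) (psiN_wedge1_23 cdx s4).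
  by rewrite (psiN_wedge1 cx s4) boundary0; zmod_solve.
- have [k1 k2 _] := Pindex_itv4 k.
  rewrite !(boundary_wedge, wedgeD, wedgeN) !(psiND, psiNN).
  rewrite (psiN_wedge2 cx k2) (psiN_wedge1_2 cx) (psiN_wedge1_2 cdx).
  rewrite (psiN_wedge1 cx k1) !(boundary_wedge, chain_linE).
  by zmod_solve.
Qed.

(** * The composite of the comparison maps and its homotopy to the identity *)

Definition PhiPsi c : chain := phiN (psiN c) + \sum_k phi k (psi k c).

Fact PhiPsi_is_linear : linear PhiPsi.
Proof.
move=> a x y; rewrite /PhiPsi psiN_is_linear phiN_is_linear.
have -> : \sum_k phi k (psi k (a *: x + y)) =
    a *: (\sum_k phi k (psi k x)) + \sum_k phi k (psi k y).
  rewrite scaler_sumr -big_split /=; apply: eq_bigr => k _.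
  by rewrite psi_is_linear phi_is_linear.
by rewrite (scalerDr a (phiN (psiN x))); zmod_solve.
Qed.
HB.instance Definition _ :=
  GRing.isLinear.Build F chain chain *:%R PhiPsi PhiPsi_is_linear.

Lemma PhiPsi0 c : (forall k, psi k c = 0) -> PhiPsi c = phiN (psiN c).
Proof.
by move=> h; rewrite /PhiPsi big1 ?addr0 // => k _; rewrite h linear0.
Qed.

Lemma PhiPsi_clean x : clean x -> PhiPsi x = 0.
Proof.
by move=> cx; rewrite PhiPsi0 ?psiN_clean ?linear0 // => k; rewrite psi_clean.
Qed.
Lemma PhiPsi_wedge13 x : clean x -> PhiPsi (wedge e13 x) = 0.
Proof.
by move=> cx; rewrite PhiPsi0 ?psiN_wedge13 ?linear0 // => k; rewrite psi_wedge13.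
Qed.
Lemma PhiPsi_wedge23 x :
  clean x -> PhiPsi (wedge e23 x) = wedge e23 x - wedge e13 x.
Proof.
move=> cx; rewrite PhiPsi0 ?psiN_wedge23 // => [|k]; last by rewrite psi_wedge23.
by rewrite /phiN !wedgeN; zmod_solve.
Qed.
Lemma PhiPsi_wedge1 s x : s \in itv n 4 n -> 
  clean x -> PhiPsi (wedge (edge v1 s) x) = wedge e23 x - wedge e13 x.
Proof.
move=> s4 cx; rewrite PhiPsi0 ?psiN_wedge1 // => [|k]; last by rewrite psi_wedge1.
by rewrite /phiN !wedgeN; zmod_solve.
Qed.
Lemma PhiPsi_wedge2 t x :
  t \in itv n 4 n -> clean x -> PhiPsi (wedge (edge v2 t) x) = 0.
Proof.
by move=> t4 cx; rewrite PhiPsi0 ?psiN_wedge2 ?linear0 // => k; rewrite psi_wedge2.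
Qed.
Lemma PhiPsi_wedge13_2 t x : t \in itv n 4 n -> clean x ->
  PhiPsi (wedge e13 (wedge (edge v2 t) x)) = 0.
Proof.
by move=> t4 cx; rewrite PhiPsi0 ?psiN_wedge13_2 ?linear0 // => k; rewrite psi_wedge13_2.
Qed.
Lemma PhiPsi_wedge1_23 s x : s \in itv n 4 n -> clean x ->
  PhiPsi (wedge (edge v1 s) (wedge e23 x)) = 0.
Proof.
by move=> t4 cx; rewrite PhiPsi0 ?psiN_wedge1_23 ?linear0 // => k; rewrite psi_wedge1_23.
Qed.
(** The terms through st, one from [phi] and one from the correcting sum of [psiN], cancel. *)
Lemma PhiPsi_wedge1_2 k x : clean x ->
  PhiPsi (wedge (edge v1 (val k).1) (wedge (edge v2 (val k).2) x)) =
    wedge (edge v1 (val k).1) (wedge (edge v2 (val k).2) x)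
    + wedge e23 (wedge (edge v1 (val k).1) x)
    - wedge e13 (wedge (edge v2 (val k).2) x).
Proof.
move=> cx; rewrite /PhiPsi psiN_wedge1_2 // (bigD1 k) //= psi_wedge1_2 // eqxx.
rewrite big1 ?addr0 => [|k' nk]; last first.
  by rewrite psi_wedge1_2 // (negPf nk) linear0.
rewrite /phi /phiN !wedgeN.
by zmod_solve.
Qed.

(** Where [homotopy] joins a cell y with e, the sum boundary (e ^ y) + e ^ boundary y returns y; the
    contributions of faces treated with another edge, or not at all, make up [PhiPsi]. *)
Lemma homotopy_eq d c :
  c \in chains (admissible (itv n 1 n)) d ->
  c - PhiPsi c = boundary (homotopy c) + homotopy (boundary c).
Proof.
pose L : {linear chain -> chain} :=
  (idfun \- PhiPsi) \- ((@boundary F _ \o homotopy) \+ (homotopy \o @boundary F _)).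
move=> hc; apply/eqP; rewrite -subr_eq0; apply/eqP.
apply: (@admissible_ind L _ _ _ _ _ _ _ _ _ _ hc)
  => {hc c} [x|x|x|s x s4|t x t4|t x t4|s x s4|k x] cx;
  have cdx := clean_boundary cx; rewrite /L /=.
- by rewrite (PhiPsi_clean cx) (homotopy_clean cx) (homotopy_clean cdx) boundary_wedge; zmod_solve.
- rewrite (PhiPsi_wedge13 cx) homotopy_wedge13 boundary_wedge homotopyD homotopyN.
  by rewrite (homotopy_clean cx) homotopy_wedge13 boundary0; zmod_solve.
- rewrite (PhiPsi_wedge23 cx) (homotopy_wedge23 cx) boundary_wedge homotopyD homotopyN.
  by rewrite (homotopy_clean cx) (homotopy_wedge23 cdx) boundary0; zmod_solve.
- rewrite (PhiPsi_wedge1 s4 cx) (homotopy_wedge1 cx s4).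
  rewrite !(boundary_wedge, wedgeD, wedgeN) !(homotopyD, homotopyN).
  by rewrite (homotopy_clean cx) (homotopy_wedge1 cdx s4); zmod_solve.
- rewrite (PhiPsi_wedge2 t4 cx) (homotopy_wedge2 cx t4).
  rewrite !(boundary_wedge, wedgeD, wedgeN) !(homotopyD, homotopyN).
  by rewrite (homotopy_clean cx) (homotopy_wedge2 cdx t4); zmod_solve.
- rewrite (PhiPsi_wedge13_2 t4 cx) ?homotopy_wedge13_2.
  rewrite !(boundary_wedge, wedgeD, wedgeN) !(homotopyD, homotopyN).
  by rewrite (homotopy_wedge2 cx t4) homotopy_wedge13_2 homotopy_wedge13 boundary0; zmod_solve.
- rewrite (PhiPsi_wedge1_23 s4 cx) ?(homotopy_wedge1_23 _ s4).
  rewrite !(boundary_wedge, wedgeD, wedgeN) !(homotopyD, homotopyN).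
  rewrite (homotopy_wedge23 cx) (homotopy_wedge1 cx s4) ?(homotopy_wedge1_23 _ s4).
  by rewrite (wedgeC e23) boundary0; zmod_solve.
- have [k1 k2 _] := Pindex_itv4 k.
  rewrite (PhiPsi_wedge1_2 k cx) ?(homotopy_wedge1_2 _ k1 k2).
  rewrite !(boundary_wedge, wedgeD, wedgeN) !(homotopyD, homotopyN).
  rewrite (homotopy_wedge2 cx k2) (homotopy_wedge1 cx k1) (homotopy_wedge1_2 _ k1 k2) boundary0.
  by zmod_solve.
Qed.

Lemma psiN_phiN x : clean x -> psiN (phiN x) = x.
Proof.
by move=> cx; rewrite linearB /= psiN_wedge13 // psiN_wedge23 // opprK add0r.
Qed.

Lemma psi_phiN k x : clean x -> psi k (phiN x) = 0.
Proof.
by move=> cx; rewrite linearB /= psi_wedge13 // psi_wedge23 // subrr.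
Qed.

Lemma phiE k x :
  phi k x = wedge (edge v1 (val k).1) (wedge (edge v2 (val k).2) x)
    - wedge (edge v1 (val k).1) (wedge e23 x)
    - wedge e13 (wedge (edge v2 (val k).2) x)
    + phiN (wedge (edge (val k).1 (val k).2) x).
Proof. by rewrite (wedgeC _ e23) opprK. Qed.

(** The value - st ^ x on 1s ^ 2t ^ x cancels the value st ^ x on the last summand of [phi]. *)
Lemma psiN_phi k x : clean x -> psiN (phi k x) = 0.
Proof.
have [k1 k2 _] := Pindex_itv4 k; move=> cx; have cw := clean_wedge k1 k2 cx.
rewrite phiE psiND (psiN_phiN cw) !(psiND, psiNN) (psiN_wedge1_2 cx).
by rewrite (psiN_wedge1_23 cx k1) (psiN_wedge13_2 cx k2); zmod_solve.
Qed.

Lemma psi_phi k k' x : clean x -> psi k (phi k' x) = if k == k' then x else 0.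
Proof.
have [k1 k2 _] := Pindex_itv4 k'; move=> cx; have cw := clean_wedge k1 k2 cx.
rewrite phiE psiD (psi_phiN _ cw) !(psiD, psiNeg) psi_wedge1_2 //.
by rewrite psi_wedge1_23 // psi_wedge13_2 // oppr0 !addr0.
Qed.

(** * Supports and degrees of the comparison maps and of the homotopy *)

Lemma edge_subset S s t : s \in S -> t \in S -> edge s t \subset S.
Proof. by move=> sS tS; apply/subsetP => w; rewrite !inE => /orP[]/eqP->. Qed.

Lemma itv1_inord a : (0 < a <= 3)%N -> (inord a : V) \in itv n 1 n.
Proof. by move=> ha; rewrite inE inordK; lia. Qed.

Lemma itv41 : itv n 4 n \subset itv n 1 n.
Proof. by apply/subsetP => w; rewrite !inE; lia. Qed.

Lemma forbiddenP e :
  reflect (e = edge v1 v2 \/ exists2 u, u \in itv n 4 n & e = edge v3 u)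
          (e \in forbidden).
Proof.
rewrite inE in_set1; apply: (iffP orP) => -[].
- by move/eqP; left.
- by case/imsetP => u; right; exists u.
- by move=> ->; left; rewrite eqxx.
- by case=> u u4 ->; right; apply: imset_f.
Qed.

Lemma chains_widen S S' X d c :
  S \subset S' -> c \in chains (matchings S X) d -> c \in chains (matchings S' X) d.
Proof.
move=> SS'; apply: chains_subset; apply/subsetP => s sS.
apply: matchings_cover (sS) _ _ => //; apply: subset_trans SS'.
by move: sS; rewrite in_matchings is_matchingE => /andP[/and3P[]].
Qed.

(** Every forbidden edge contains 1 or 3, so none fits inside S. *)
Lemma chains_matching_complex S d c :
    v1 \notin S -> v3 \notin S ->
  (c \in chains (matching_complex S) d) = (c \in chains (admissible S) d).
Proof.
move=> nv1 nv3; apply/idP/idP; apply: chains_subset; apply/subsetP => s.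
  rewrite inE => sS; have sS0 : s \in faces (matchings S set0).
    by rewrite in_matchings sS -setI_eq0 setI0 eqxx.
  have sc : cover s \subset S by move: sS; rewrite is_matchingE => /and3P[].
  apply: matchings_cover sS0 sc _ => e /forbiddenP[->|[u _ ->]] /subsetP.
    by move/(_ v1 (mem_edgel _ _)); rewrite (negPf nv1).
  by move/(_ v3 (mem_edgel _ _)); rewrite (negPf nv3).
by rewrite in_matchings inE => /andP[].
Qed.

Lemma chains_wedge_admissible S S' e d d' c :
    e \subset S -> #|e| = 2 -> [disjoint e & S'] -> S' \subset S ->
    e \notin forbidden -> d = d' + 1 ->
  c \in chains (admissible S') d' -> wedge e c \in chains (admissible S) d.
Proof.
move=> eS e2 eS' S'S nX dd'; apply: chains_wedge dd' => t tS' _.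
exact: matchings_setU1 tS'.
Qed.

Lemma card_edge s t : s != t -> #|edge s t| = 2.
Proof. by rewrite cards2 => ->. Qed.

Lemma edge_disjoint S s t : s \notin S -> t \notin S -> [disjoint edge s t & S].
Proof.
move=> ns nt; rewrite disjoint_subset; apply/subsetP => w.
by rewrite !inE => /orP[]/eqP->.
Qed.

Lemma edge_allowed s t :
    s != v3 -> t != v3 \/ t = v3 /\ s \in [set v1; v2] ->
    ~~ [&& s \in [set v1; v2] & t \in [set v1; v2]] ->
  edge s t \notin forbidden.
Proof.
move=> s3 t3 h; apply/negP => /forbiddenP[] e12.
  have := mem_edgel s t; have := mem_edger s t; rewrite e12 => tt ss.
  by move: h; rewrite tt ss.
case: e12 => u u4 e12; have v3e : v3 \in edge s t by rewrite e12 mem_edgel.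
have ue : u \in edge s t by rewrite e12 mem_edger.
move: v3e; rewrite !inE eq_sym (negPf s3) /= eq_sym => /eqP et; subst t.
case: t3 => [/eqP//|[_]]; move: ue; rewrite !inE itv4_inord // orbF => /eqP <-.
by rewrite !itv4_inord.
Qed.

Lemma edge13_allowed : e13 \notin forbidden.
Proof.
apply: edge_allowed; rewrite ?inord_eq; try lia.
  by right; rewrite !inE eqxx.
by rewrite !inE !inord_eq; lia.
Qed.

Lemma edge23_allowed : e23 \notin forbidden.
Proof.
apply: edge_allowed; rewrite ?inord_eq; try lia.
  by right; rewrite !inE eqxx orbT.
by rewrite !inE !inord_eq; lia.
Qed.

Lemma edge_itv4_allowed s t : s != v3 -> t \in itv n 4 n -> edge s t \notin forbidden.
Proof.
move=> s3 t4; apply: edge_allowed => //; first by left; rewrite itv4_inord.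
by rewrite !inE !(itv4_inord _ t4) //= andbF.
Qed.

Local Notation Nst k := (itv n 4 n :\: [set (val k).1; (val k).2]).

Lemma itv4_notin a : (a <= 3)%N -> inord a \notin itv n 4 n.
Proof. by move=> a3; rewrite inE inordK; lia. Qed.

Lemma Nst_notin k a : (a <= 3)%N -> inord a \notin Nst k.
Proof. by move=> a3; rewrite inE (negPf (itv4_notin _)) ?andbF. Qed.

Lemma phiN_chains d d' c :
    d = d' + 1 ->
  c \in chains (admissible (itv n 4 n)) d' ->
  phiN c \in chains (admissible (itv n 1 n)) d.
Proof.
move=> dd' hc; rewrite rpredB //.
  apply: chains_wedge_admissible hc; rewrite ?edge13_allowed ?itv41 //.
  - by rewrite edge_subset ?itv1_inord.
  - by rewrite card_edge ?v1_neq_v3.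
  - by rewrite edge_disjoint ?itv4_notin.
apply: chains_wedge_admissible hc; rewrite ?edge23_allowed ?itv41 //.
- by rewrite edge_subset ?itv1_inord.
- by rewrite card_edge ?v2_neq_v3.
- by rewrite edge_disjoint ?itv4_notin.
Qed.

Lemma wedge_st_chains k d d' c :
    d = d' + 1 ->
  c \in chains (admissible (Nst k)) d' ->
  wedge (edge (val k).1 (val k).2) c \in chains (admissible (itv n 4 n)) d.
Proof.
move=> dd'; have [k1 k2 nk] := Pindex_itv4 k.
apply: chains_wedge_admissible dd'; rewrite ?edge_subset ?card_edge ?subsetDl //.
- by rewrite edge_disjoint // !inE eqxx ?orbT.
- by rewrite edge_itv4_allowed ?itv4_inord.
Qed.

Lemma phi_chains k d d' c :
    d = d' + 1 + 1 ->
  c \in chains (admissible (Nst k)) d' ->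
  phi k c \in chains (admissible (itv n 1 n)) d.
Proof.
move=> dd' hc; have [k1 k2 nk] := Pindex_itv4 k.
have k1n := subsetP itv41 _ k1; have k2n := subsetP itv41 _ k2.
have v2k1 : v2 != (val k).1 by rewrite eq_sym itv4_inord.
have v1k1 : v1 != (val k).1 by rewrite eq_sym itv4_inord.
have v2k2 : v2 != (val k).2 by rewrite eq_sym itv4_inord.
have nk' : (val k).2 != (val k).1 by rewrite eq_sym.
have v12 := v1_neq_v2.
have v13 := v1_neq_v3.
have v23 := v2_neq_v3.
(* The ground set omits s, so that 1s can still be joined. *)
have h2 : wedge (edge v2 (val k).2) c \in
    chains (admissible (v2 |: (itv n 4 n :\ (val k).1))) (d' + 1).
  apply: chains_wedge_admissible hc => //.
  - by rewrite edge_subset ?setU11 // in_setU1 in_setD1 nk' k2 orbT.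
  - by rewrite card_edge.
  - by rewrite edge_disjoint ?Nst_notin // !inE eqxx orbT.
  - apply/subsetP => w; rewrite !inE negb_or -andbA => /and3P[-> _ ->].
    by rewrite orbT.
  - by rewrite edge_itv4_allowed.
have h1 : wedge (edge v1 (val k).1) c \in
    chains (admissible (v1 |: itv n 4 n)) (d' + 1).
  apply: chains_wedge_admissible hc => //.
  - by rewrite edge_subset ?setU11 // inE k1 orbT.
  - by rewrite card_edge.
  - by rewrite edge_disjoint ?Nst_notin // !inE eqxx.
  - by apply: subset_trans (subsetDl _ _) (subsetUr _ _).
  - by rewrite edge_itv4_allowed.
apply: rpredD; first apply: rpredB; first apply: rpredD.
- apply: chains_wedge_admissible h2 => //.
  + by rewrite edge_subset ?itv1_inord.
  + by rewrite card_edge.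
  + rewrite edge_disjoint // in_setU1 in_setD1 negb_or.
      by rewrite v12 (negPf (itv4_notin _)) ?andbF.
    by rewrite eq_sym v2k1 eqxx.
  + rewrite subUset sub1set itv1_inord //=.
    by apply: subset_trans (subsetDl _ _) itv41.
  + by rewrite edge_itv4_allowed.
- apply: chains_wedge_admissible h1 => //.
  + by rewrite edge_subset ?itv1_inord.
  + by rewrite card_edge.
  + by rewrite edge_disjoint // in_setU1 negb_or itv4_notin // eq_sym ?v12 ?v13.
  + by rewrite subUset sub1set itv1_inord //= itv41.
  + exact: edge23_allowed.
- apply: chains_wedge_admissible h2 => //.
  + by rewrite edge_subset ?itv1_inord.
  + by rewrite card_edge.
  + rewrite edge_disjoint // in_setU1 in_setD1 negb_or.
      by rewrite v12 (negPf (itv4_notin _)) ?andbF.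
    by rewrite eq_sym v23 (negPf (itv4_notin _)) ?andbF.
  + rewrite subUset sub1set itv1_inord //=.
    by apply: subset_trans (subsetDl _ _) itv41.
  + exact: edge13_allowed.
- by apply: phiN_chains dd' _; apply: wedge_st_chains hc.
Qed.

Lemma avoid_chains S v d c :
  c \in chains (admissible S) d -> avoid v c \in chains (admissible S) d.
Proof. by move/(chains_avoid v); apply: chains_widen; apply: subsetDl. Qed.

Lemma homotopy_chains d d' c :
    d = d' + 1 ->
  c \in chains (admissible (itv n 1 n)) d' ->
  homotopy c \in chains (admissible (itv n 1 n)) d.
Proof.
move=> dd' hc; have v13 := v1_neq_v3.
rewrite rpredD //.
  apply: chains_wedge_admissible dd' (chains_avoid _ (chains_avoid _ hc)).
  - by rewrite edge_subset ?itv1_inord.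
  - by rewrite card_edge.
  - by rewrite edge_disjoint // !inE eqxx ?andbF.
  - by apply: subset_trans (subsetDl _ _) (subsetDl _ _).
  - exact: edge13_allowed.
have hc' : c - avoid v1 c \in chains (admissible (itv n 1 n)) d'.
  by rewrite rpredB // avoid_chains.
apply: chains_wedge_admissible dd' (chains_avoid _ (chains_avoid _ hc')).
- by rewrite edge_subset ?itv1_inord.
- by rewrite card_edge // v2_neq_v3.
- by rewrite edge_disjoint // !inE eqxx ?andbF.
- by apply: subset_trans (subsetDl _ _) (subsetDl _ _).
- exact: edge23_allowed.
Qed.

Lemma chains_restrict3 S d c :
    S \subset itv n 1 n -> v1 \notin S -> v2 \notin S ->
    c \in chains (admissible S) d ->
  c \in chains (admissible (S :\ v3)) d.
Proof.
move=> Sn n1 n2 hc; have [_ _ <-] := clean_chain Sn n1 n2 hc.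
exact: chains_avoid.
Qed.

Lemma itv1_sub4 S :
    S \subset itv n 1 n -> v1 \notin S -> v2 \notin S -> v3 \notin S ->
  S \subset itv n 4 n.
Proof.
move=> /subsetP Sn n1 n2 n3; apply/subsetP => w wS.
case: (itv1_cases (Sn _ wS)) => // ew; move: wS; rewrite ew.
- by rewrite (negPf n1).
- by rewrite (negPf n2).
- by rewrite (negPf n3).
Qed.

Lemma psi_chains k d d' c :
    d = d' + 1 + 1 ->
  c \in chains (admissible (itv n 1 n)) d ->
  psi k c \in chains (admissible (Nst k)) d'.
Proof.
move=> -> /(chains_contract_matchings (edge v1 (val k).1)).
move/(chains_contract_matchings (edge v2 (val k).2)); rewrite -/(psi k c).
set S := _ :\: edge v2 _.
have Sn : S \subset itv n 1 n by apply: subset_trans (subsetDl _ _) (subsetDl _ _).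
have n1 : v1 \notin S by rewrite !inE eqxx /= !andbF.
have n2 : v2 \notin S by rewrite !inE eqxx.
move/(chains_restrict3 Sn n1 n2); apply: chains_widen.
have S4 : S :\ v3 \subset itv n 4 n.
  apply: itv1_sub4; rewrite ?in_setD1 ?eqxx ?(negPf n1) ?(negPf n2) ?andbF //.
  exact: subset_trans (subsetDl _ _) Sn.
rewrite subsetD S4 disjoint_sym disjoint_subset /=; apply/subsetP => w.
by rewrite !inE => /orP[]/eqP->; rewrite eqxx ?orbT /= ?andbF.
Qed.

Lemma psiN_chains d d' c :
    d = d' + 1 ->
  c \in chains (admissible (itv n 1 n)) d ->
  psiN c \in chains (admissible (itv n 4 n)) d'.
Proof.
move=> dd' hc; have hcontr e : contract e c \in chains (admissible (itv n 1 n)) d'.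
  apply: (@chains_widen (itv n 1 n :\: e)); first exact: subsetDl.
  by apply: chains_contract_matchings; rewrite -dd'.
rewrite rpredN; apply: rpredD; last first.
  apply: rpred_sum => k _; apply: wedge_st_chains (esym (subrK 1 d')) _.
  by apply: psi_chains hc; rewrite dd' subrK.
have : contract e23 c + \sum_(s in itv n 4 n) contract (edge v1 s) c
  \in chains (admissible (itv n 1 n)) d'.
  apply: rpredD; first exact: hcontr.
  by apply: rpred_sum => s _; exact: hcontr.
move/(chains_avoid v2)/(chains_avoid v1).
have Sn : itv n 1 n :\ v2 :\ v1 \subset itv n 1 n.
  by apply: subset_trans (subsetDl _ _) (subsetDl _ _).
move/(chains_restrict3 Sn); rewrite !in_setD1 !eqxx /= andbF => /(_ isT isT).
apply: chains_widen; apply: itv1_sub4; rewrite ?in_setD1 ?eqxx ?andbF //.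
exact: subset_trans (subsetDl _ _) Sn.
Qed.

Lemma contract_star0 u d c :
    u \in itv n 4 n -> c \in chains (admissible (itv n 1 n)) d ->
  contract (edge v3 u) c = 0.
Proof.
move=> u4 /chainsP hc; apply/ffunP => s; rewrite !ffunE; case: ifP => // _.
rewrite hc ?mulr0 //; apply/negP => /andP[sK _].
have [_ _ /negP[]] := matchings_edge sK (setU11 _ _).
by apply/forbiddenP; right; exists u.
Qed.

(** * Action of the comparison maps on cycles and boundaries *)

Local Notation K := (deletion (matching_complex (itv n 1 n)) (edge12 n)).
Local Notation A := (admissible (itv n 1 n)).
Local Notation KQ u :=
  (deletion (matching_complex (itv n 1 n :\: [set v3; val u])) (edge12 n)).
Local Notation N := (matching_complex (itv n 4 n)).
Local Notation NP k := (matching_complex (Nst k)).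

Lemma chainsN d c : (c \in chains N d) = (c \in chains (admissible (itv n 4 n)) d).
Proof. by rewrite chains_matching_complex ?itv4_notin. Qed.

Lemma chainsNP k d c : (c \in chains (NP k) d) = (c \in chains (admissible (Nst k)) d).
Proof. by rewrite chains_matching_complex ?Nst_notin. Qed.

Lemma cleanN d c : c \in chains N d -> clean c.
Proof. by rewrite chainsN; apply: clean_chain itv41 _ _; apply: itv4_notin. Qed.

Lemma cleanNP k d c : c \in chains (NP k) d -> clean c.
Proof.
rewrite chainsNP; apply: clean_chain; rewrite ?Nst_notin //.
exact: subset_trans (subsetDl _ _) itv41.
Qed.

Lemma faces_deletion S e :
  faces (deletion (matching_complex S) e) = faces (matchings S [set e]).
Proof. by apply/setP => s; rewrite !inE disjoint_sym disjoints1. Qed.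

Lemma psi_cycles k d c : c \in cycles A d -> psi k c \in cycles (NP k) (d - 2).
Proof.
case/cyclesP => hc bc; apply/cyclesP; rewrite boundary_psi bc linear0; split=> //.
by rewrite chainsNP; apply: psi_chains hc; lia.
Qed.

Lemma psiN_cycles d c : c \in cycles A d -> psiN c \in cycles N (d - 1).
Proof.
case/cyclesP => hc bc; apply/cyclesP; split.
  by rewrite chainsN; apply: psiN_chains hc; lia.
by rewrite (boundary_psiN hc) bc linear0 oppr0.
Qed.

Lemma phiN_cycles d c : c \in cycles N (d - 1) -> phiN c \in cycles A d.
Proof.
case/cyclesP; rewrite chainsN => hc bc; apply/cyclesP.
rewrite boundary_phiN bc linear0 oppr0; split=> //.
by apply: phiN_chains hc; lia.
Qed.

Lemma phi_cycles k d c : c \in cycles (NP k) (d - 2) -> phi k c \in cycles A d.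
Proof.
case/cyclesP; rewrite chainsNP => hc bc; apply/cyclesP.
rewrite boundary_phi bc linear0; split=> //.
by apply: phi_chains hc; lia.
Qed.

Lemma psi_bounding k d c : c \in bounding A d -> psi k c \in bounding (NP k) (d - 2).
Proof.
case/boundingP => b hb <-; apply/boundingP; exists (psi k b).
  by rewrite chainsNP; apply: psi_chains hb; lia.
exact: boundary_psi.
Qed.

Lemma psiN_bounding d c : c \in bounding A d -> psiN c \in bounding N (d - 1).
Proof.
case/boundingP => b hb <-; apply/boundingP; exists (- psiN b).
  by rewrite rpredN chainsN; apply: psiN_chains hb; lia.
by rewrite boundaryN (boundary_psiN hb) opprK.
Qed.

Lemma phiN_bounding d c : c \in bounding N (d - 1) -> phiN c \in bounding A d.
Proof.
case/boundingP => b hb <-; apply/boundingP; exists (- phiN b).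
  by rewrite rpredN; apply: phiN_chains (esym (subrK _ _)) _; rewrite -chainsN -addrAC.
by rewrite boundaryN boundary_phiN opprK.
Qed.

Lemma phi_bounding k d c : c \in bounding (NP k) (d - 2) -> phi k c \in bounding A d.
Proof.
case/boundingP => b hb <-; apply/boundingP; exists (phi k b).
  by move: hb; rewrite chainsNP; apply: phi_chains; lia.
exact: boundary_phi.
Qed.

Lemma PhiPsi_bounding d c : c \in cycles A d -> c - PhiPsi c \in bounding A d.
Proof.
case/cyclesP => hc bc; apply/boundingP; exists (homotopy c).
  by apply: homotopy_chains hc.
by rewrite (homotopy_eq hc) bc linear0 addr0.
Qed.

(** * The pair (K, A) and the links of the edges 3u *)

Lemma admissible_sub : faces A \subset faces K.
Proof.
apply/subsetP => s; rewrite faces_deletion !in_matchings => /andP[-> sX] /=.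
apply: disjointWr sX; apply/subsetP => e; rewrite inE => /eqP->.
by apply/forbiddenP; left.
Qed.

(** Removing the vertex 3 removes all forbidden edges 3w, so link chains are chains of A and can be
    summed there. *)
Lemma KQ_sub (u : Qindex n) : faces (KQ u) \subset faces A.
Proof.
rewrite faces_deletion; apply/subsetP => s sK.
have sc : cover s \subset itv n 1 n :\: [set v3; val u].
  by move: sK; rewrite in_matchings is_matchingE => /andP[/and3P[]].
have : s \in faces (admissible (itv n 1 n :\: [set v3; val u])).
  apply: matchings_cover sK sc _ => e /forbiddenP[->|[w _ ->]]; first by rewrite set11.
  by move/subsetP/(_ v3 (mem_edgel _ _)); rewrite !inE eqxx.
move=> sA; apply: matchings_cover sA _ _ => //.
exact: subset_trans sc (subsetDl _ _).
Qed.

Lemma val_itv4 (u : Qindex n) : val u \in itv n 4 n.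
Proof. exact: valP. Qed.

Lemma contract_KQ (u : Qindex n) d c :
  c \in chains K d -> contract (edge v3 (val u)) c \in chains (KQ u) (d - 1).
Proof.
apply: chains_contract; last by rewrite subrK.
by move=> s; rewrite !faces_deletion; apply: matchings_setD1.
Qed.

Lemma wedge_KQ (u : Qindex n) d c :
  c \in chains (KQ u) (d - 1) -> wedge (edge v3 (val u)) c \in chains K d.
Proof.
have u4 := val_itv4 u.
apply: chains_wedge; last by rewrite subrK.
move=> t; rewrite !faces_deletion => tK _; apply: matchings_setU1 tK.
- by rewrite edge_subset ?itv1_inord // (subsetP itv41).
- by rewrite card_edge // eq_sym itv4_inord.
- by rewrite edge_disjoint // !inE eqxx ?orbT.
- exact: subsetDl.
- rewrite inE; apply/eqP => /setP/(_ v3); rewrite !inE eqxx /=.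
  by rewrite ![v3 == _]eq_sym (negPf v1_neq_v3) (negPf v2_neq_v3).
Qed.

Lemma contract_other_KQ (u v : Qindex n) d c :
  c \in chains (KQ u) d -> contract (edge v3 (val v)) c = 0.
Proof.
have sub : faces (KQ u) \subset
    faces (matchings (itv n 1 n :\: [set v3; val u]) [set edge12 n]).
  by rewrite faces_deletion.
move/(chains_subset sub); apply: contract_notsub.
by apply/negP => /subsetP/(_ v3 (mem_edgel _ _)); rewrite !inE eqxx.
Qed.

(** Lifts a family of link chains to K: a section of the projection to the relative chains of (K,
    A), which the contractions at the 3u compute. *)
Definition star3 (y : Qindex n -> chain) : chain :=
  \sum_(u : Qindex n) wedge (edge v3 (val u)) (y u).

Lemma contract_star3 d (y : Qindex n -> chain) (u : Qindex n) :
    (forall v : Qindex n, y v \in chains (KQ v) d) ->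
  contract (edge v3 (val u)) (star3 y) = y u.
Proof.
move=> hy; rewrite /star3 linear_sum (bigD1 u) //= contract_wedge.
rewrite (contract_other_KQ _ (hy u)) wedge0 subr0 big1 ?addr0 // => v nvu.
rewrite contract_wedgeN ?(contract_other_KQ _ (hy v)) ?wedge0 ?oppr0 //.
by rewrite edge_neq // 1?eq_sym ?itv4_inord ?val_itv4.
Qed.

(** For chains of the links the first sum lies in A; it is the connecting map at chain level. *)
Lemma boundary_star3 (y : Qindex n -> chain) :
  boundary (star3 y) = \sum_(u : Qindex n) y u - star3 (fun u : Qindex n => boundary (y u)).
Proof.
rewrite /star3 linear_sum /= -sumrB; apply: eq_bigr => u _.
exact: boundary_wedge.
Qed.

Lemma star3_chains d (y : Qindex n -> chain) :
  (forall v : Qindex n, y v \in chains (KQ v) (d - 1)) -> star3 y \in chains K d.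
Proof. by move=> hy; apply: rpred_sum => u _; apply: wedge_KQ. Qed.

(** A nonzero coefficient on a face through 3u would survive in the contraction at 3u. *)
Lemma chains_admissible d c :
    c \in chains K d ->
    (forall u : Qindex n, contract (edge v3 (val u)) c = 0) ->
  c \in chains A d.
Proof.
move=> /chainsP hc c0; apply/chainsP => s.
have [sK|nsK] := boolP ((s \in faces K) && (#|s|%:Z == d + 1)); last by rewrite hc.
case/andP: sK => sK ->; rewrite andbT => nsA.
have : exists2 e, e \in s & e \in forbidden.
  apply/exists_inP; apply: contraR nsA => /exists_inPn nX.
  move: sK; rewrite faces_deletion !in_matchings => /andP[-> _] /=.
  by rewrite disjoint_subset; apply/subsetP => e /nX.
case=> e es /forbiddenP[e12|[u u4 eu]].
  move: sK; rewrite faces_deletion in_matchings => /andP[_].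
  by rewrite disjoint_sym disjoints1 /edge12 -e12 es.
have := wedge_contractE e c s; rewrite es => <-.
by rewrite eu (c0 (Sub u u4)) wedge0 ffunE.
Qed.

Lemma star3_split d c :
    c \in chains K d ->
  c - star3 (fun u : Qindex n => contract (edge v3 (val u)) c) \in chains A d.
Proof.
move=> hc; have hy (u : Qindex n) : contract (edge v3 (val u)) c \in chains (KQ u) (d - 1).
  exact: contract_KQ.
apply: chains_admissible => [|u]; first by rewrite rpredB ?star3_chains.
by rewrite contractD contractN (contract_star3 _ hy) subrr.
Qed.

(** * The long exact sequence *)

Definition Phi w (x : Pindex n -> chain) : chain := phiN w + \sum_k phi k (x k).

Lemma Phi_lin a w w' w'' (x x' x'' : Pindex n -> chain) :
  Phi w x - (a *: Phi w' x' + Phi w'' x'') =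
  Phi (w - (a *: w' + w'')) (fun k => x k - (a *: x' k + x'' k)).
Proof.
rewrite /Phi; have -> : phiN (w - (a *: w' + w'')) = phiN w - (a *: phiN w' + phiN w'').
  by rewrite -phiN_is_linear; exact: (linearB phiN).
have -> : \sum_k phi k (x k - (a *: x' k + x'' k)) =
    \sum_k phi k (x k) - (a *: (\sum_k phi k (x' k)) + \sum_k phi k (x'' k)).
  rewrite scaler_sumr -big_split -sumrB /=; apply: eq_bigr => k _.
  by rewrite -phi_is_linear; exact: (linearB (phi k)).
by rewrite (scalerDr a (phiN w')); zmod_solve.
Qed.

Lemma Phi_cycles d w (x : Pindex n -> chain) :
    w \in cycles N (d - 1) -> (forall k, x k \in cycles (NP k) (d - 2)) ->
  Phi w x \in cycles A d.
Proof.
move=> hw hx; apply: rpredD; first exact: phiN_cycles.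
by apply: rpred_sum => k _; apply: phi_cycles.
Qed.

Lemma Phi_bounding d w (x : Pindex n -> chain) :
    w \in bounding N (d - 1) -> (forall k, x k \in bounding (NP k) (d - 2)) ->
  Phi w x \in bounding A d.
Proof.
move=> hw hx; apply: rpredD; first exact: phiN_bounding.
by apply: rpred_sum => k _; apply: phi_bounding.
Qed.

Lemma psiN_Phi d w (x : Pindex n -> chain) :
    w \in cycles N (d - 1) -> (forall k, x k \in cycles (NP k) (d - 2)) ->
  psiN (Phi w x) = w.
Proof.
move=> /andP[hw _] hx; rewrite /Phi psiND (psiN_phiN (cleanN hw)) linear_sum /=.
rewrite big1 ?addr0 // => k _; apply: psiN_phi.
by have /andP[] := hx k; move/cleanNP.
Qed.

Lemma psi_Phi k d w (x : Pindex n -> chain) :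
    w \in cycles N (d - 1) -> (forall k, x k \in cycles (NP k) (d - 2)) ->
  psi k (Phi w x) = x k.
Proof.
move=> /andP[hw _] hx; rewrite /Phi psiD (psi_phiN _ (cleanN hw)) add0r linear_sum /=.
have cx k' : clean (x k') by have /andP[/cleanNP] := hx k'.
rewrite (bigD1 k) //= psi_phi // eqxx big1 ?addr0 // => k' nk.
by rewrite psi_phi // eq_sym (negPf nk).
Qed.

(** * Representatives of families of classes, and the maps of the sequence *)

Definition qrep d (y : Q F n d) (u : Qindex n) : chain :=
  hrep ((y : dsum (fun u : Qindex n => homology F (KQ u) d)) u).

Definition prep d (x : P F n d) k : chain :=
  hrep ((x : dsum (fun k : Pindex n => homology F (NP k) d)) k).

Lemma qrep_cycles d (y : Q F n d) (u : Qindex n) : qrep y u \in cycles (KQ u) d.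
Proof. exact: hrep_cycle. Qed.

Lemma prep_cycles d (x : P F n d) k : prep x k \in cycles (NP k) d.
Proof. exact: hrep_cycle. Qed.

Lemma qrep_lin d a (y y' : Q F n d) (u : Qindex n) :
  qrep (a *: y + y') u - (a *: qrep y u + qrep y' u) \in bounding (KQ u) d.
Proof. by rewrite /qrep dsumDE dsumZE; exact: hrep_lin. Qed.

Lemma prep_lin d a (x x' : P F n d) k :
  prep (a *: x + x') k - (a *: prep x k + prep x' k) \in bounding (NP k) d.
Proof. by rewrite /prep dsumDE dsumZE; exact: hrep_lin. Qed.

Lemma sum_qrep_cycles d (y : Q F n d) :
  \sum_(u : Qindex n) qrep y u \in cycles A d.
Proof.
apply: rpred_sum => u _; apply: cycles_subset (KQ_sub u) _; exact: qrep_cycles.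
Qed.

Lemma sum_qrep_lin d a (y y' : Q F n d) :
  \sum_(u : Qindex n) qrep (a *: y + y') u -
  (a *: (\sum_(u : Qindex n) qrep y u) + \sum_(u : Qindex n) qrep y' u)
    \in bounding A d.
Proof.
rewrite scaler_sumr -big_split -sumrB /=; apply: rpred_sum => u _.
by apply: bounding_subset (KQ_sub u) _; apply: qrep_lin.
Qed.

(** First coordinate of the connecting map: the relative cycle [star3 (qrep y)] has boundary the sum
    of the [qrep y u], a cycle of A whose class is read off by [psiN], and by the [psi k] in
    [connectingP]. *)
Definition connectingN d (y : Q F n d) : H4 F n (d - 1) :=
  hclass N (d - 1) (psiN (\sum_(u : Qindex n) qrep y u)).

Definition connectingP d (y : Q F n d) : P F n (d - 2) :=
  [ffun k => hclass (NP k) (d - 2) (psi k (\sum_(u : Qindex n) qrep y u))]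
    : dsum (fun k : Pindex n => homology F (NP k) (d - 2)).

Definition connecting d (y : Q F n d) : (H4 F n (d - 1) * P F n (d - 2))%type :=
  (connectingN y, connectingP y).

(** The splitting of the homology of A, used backwards, followed by the map induced by A in K. *)
Definition inclusion d (p : (H4 F n (d - 1) * P F n (d - 2))%type) : Hdel F n d :=
  hclass K d (Phi (hrep p.1) (prep p.2)).

Definition link d (z : Hdel F n d) : Q F n (d - 1) :=
  [ffun u : Qindex n => hclass (KQ u) (d - 1) (contract (edge v3 (val u)) (hrep z))]
     : dsum (fun u : Qindex n => homology F (KQ u) (d - 1)).

Lemma contract_cycles (u : Qindex n) d c :
  c \in cycles K d -> contract (edge v3 (val u)) c \in cycles (KQ u) (d - 1).
Proof.
case/cyclesP=> hc bc; apply/cyclesP; split; first exact: contract_KQ.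
by rewrite boundary_contract bc contract0 oppr0.
Qed.

Lemma contract_bounding (u : Qindex n) d c :
  c \in bounding K d -> contract (edge v3 (val u)) c \in bounding (KQ u) (d - 1).
Proof.
case/boundingP => b hb <-; apply/boundingP.
exists (- contract (edge v3 (val u)) b).
  by rewrite rpredN addrAC; apply: contract_KQ.
by rewrite boundaryN boundary_contract opprK.
Qed.

Fact connectingN_is_linear d : linear (@connectingN d).
Proof.
apply: hclass_linear => [y|a y y'].
  by apply: psiN_cycles; apply: sum_qrep_cycles.
rewrite -psiN_is_linear -psiNN -psiND.
by apply: psiN_bounding; apply: sum_qrep_lin.
Qed.

Fact connectingP_is_linear d : linear (@connectingP d).
Proof.
apply: dsum_linear => k a y y'; rewrite !ffunE.
move: a y y'; apply: (@hclass_linear F _ (NP k) (d - 2) (Q F n d)) => [y|a y y'].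
  by apply: psi_cycles; apply: sum_qrep_cycles.
rewrite -psi_is_linear -psiNeg -psiD.
by apply: psi_bounding; apply: sum_qrep_lin.
Qed.

Fact connecting_is_linear d : linear (@connecting d).
Proof.
move=> a y y'; rewrite /connecting connectingN_is_linear connectingP_is_linear.
by [].
Qed.
HB.instance Definition _ d :=
  GRing.isLinear.Build F _ _ *:%R (@connecting d) (@connecting_is_linear d).

Fact inclusion_is_linear d : linear (@inclusion d).
Proof.
apply: (@hclass_linear _ _ _ _ _
  (fun p : (H4 F n (d - 1) * P F n (d - 2))%type => Phi (hrep p.1) (prep p.2))).
  move=> p; apply: cycles_subset admissible_sub _; apply: Phi_cycles.
    exact: hrep_cycle.
  by move=> k; apply: prep_cycles.
move=> a p p'; apply: bounding_subset admissible_sub _.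
rewrite Phi_lin; apply: Phi_bounding; first exact: hrep_lin.
by move=> k; apply: prep_lin.
Qed.
HB.instance Definition _ d :=
  GRing.isLinear.Build F _ _ *:%R (@inclusion d) (@inclusion_is_linear d).

Fact link_is_linear d : linear (@link d).
Proof.
apply: dsum_linear => u a z z'; rewrite !ffunE.
apply: (@hclass_linear _ _ _ _ _
  (fun z : Hdel F n d => contract (edge v3 (val u)) (hrep z))).
  by move=> {}z; apply: contract_cycles; apply: hrep_cycle.
move=> {}a {}z {}z'.
rewrite -contract_is_linear -contractN -contractD.
by apply: contract_bounding; apply: hrep_lin.
Qed.
HB.instance Definition _ d :=
  GRing.isLinear.Build F _ _ *:%R (@link d) (@link_is_linear d).

Lemma PhiPsiB w (x : Pindex n -> chain) c :
  Phi w x - PhiPsi c = Phi (w - psiN c) (fun k => x k - psi k c).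
Proof.
rewrite /Phi /PhiPsi opprD addrACA -sumrB; congr (_ + _).
  exact: esym (linearB phiN _ _).
by apply: eq_bigr => k _; exact: esym (linearB (phi k) _ _).
Qed.

Lemma connectingE0 d (y : Q F n d) :
  connecting y = 0 <->
    psiN (\sum_(u : Qindex n) qrep y u) \in bounding N (d - 1) /\
    forall k, psi k (\sum_(u : Qindex n) qrep y u) \in bounding (NP k) (d - 2).
Proof.
have cN := psiN_cycles (sum_qrep_cycles y).
have cP k := psi_cycles k (sum_qrep_cycles y).
split=> [[/hclass0 e1 e2]|[/hclass0 e1 e2]].
  split=> [|k]; first exact: e1.
  apply/hclass0 => //; have := congr1 (fun f : P F n (d - 2) =>
    (f : dsum (fun k : Pindex n => homology F (NP k) (d - 2))) k) e2.
  by rewrite ffunE dsum0E.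
congr (_, _); first exact: e1.
by apply/ffunP => k; rewrite ffunE dsum0E; apply/hclass0.
Qed.

Lemma linkE d (z : Hdel F n d) (y : Q F n (d - 1)) :
  link z = y <-> forall u : Qindex n,
    contract (edge v3 (val u)) (hrep z) - qrep y u \in bounding (KQ u) (d - 1).
Proof.
have cz (u : Qindex n) := contract_cycles u (hrep_cycle z).
split=> [<- u|h].
  rewrite /qrep ffunE -rpredN opprB.
  exact: hrep_hclass.
apply/ffunP => u; rewrite ffunE -[RHS]hclassK.
by apply/hclass_eq; [exact: cz | exact: hrep_cycle | exact: h].
Qed.

Lemma contract_Phi d w (x : Pindex n -> chain) (u : Qindex n) :
    w \in cycles N (d - 1) -> (forall k, x k \in cycles (NP k) (d - 2)) ->
  contract (edge v3 (val u)) (Phi w x) = 0.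
Proof.
move=> hw hx; have /andP[hP _] := Phi_cycles hw hx.
exact: contract_star0 (val_itv4 u) hP.
Qed.

Lemma star3_boundary d (y : Qindex n -> chain) :
    (forall u : Qindex n, y u \in cycles (KQ u) d) ->
  boundary (star3 y) = \sum_(u : Qindex n) y u.
Proof.
move=> hy; rewrite boundary_star3 -[RHS]subr0; congr (_ - _).
by apply: big1 => u _; have /cyclesP[_ ->] := hy u; rewrite wedge0.
Qed.

(** * Exactness at the three kinds of terms *)

Lemma exact_at_inclusion d : exact_at (@connecting d) (@inclusion d).
Proof.
case=> w x; have hw : hrep w \in cycles N (d - 1) by apply: hrep_cycle.
have hx k : prep x k \in cycles (NP k) (d - 2) by apply: prep_cycles.
have hP := Phi_cycles hw hx; have hPK := cycles_subset admissible_sub hP.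
split=> [/hclass0-/(_ hPK)/boundingP[b hb bE]|[y]].
  (* A chain b of K whose boundary lies in A is a relative cycle; its contractions at the 3u
     represent the preimage. *)
  pose c (u : Qindex n) := contract (edge v3 (val u)) b.
  have cc u : c u \in cycles (KQ u) d.
    apply/cyclesP; split; first by have := contract_KQ u hb; rewrite addrK.
    by rewrite boundary_contract bE (contract_Phi _ hw hx) oppr0.
  pose y : Q F n d := [ffun u : Qindex n => hclass (KQ u) d (c u)]
    : dsum (fun u : Qindex n => homology F (KQ u) d).
  (* The chain b - [star3 c] lies in A and bounds the difference between Phi and the sum of the c u;
     passing from c u to [qrep y u] costs boundaries of the links only. *)
  have dy : \sum_(u : Qindex n) qrep y u - Phi (hrep w) (prep x) \in bounding A d.
    rewrite -(subrKA (\sum_(u : Qindex n) c u)) rpredD //.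
      rewrite -sumrB rpred_sum // => u _; apply: bounding_subset (KQ_sub u) _.
      by rewrite /qrep ffunE; apply: hrep_hclass.
    rewrite -rpredN opprB; apply/boundingP; exists (b - star3 c).
      by have := star3_split hb.
    by rewrite boundaryD boundaryN bE (star3_boundary cc).
  exists y; congr (_, _).
    rewrite -[RHS]hclassK; apply/hclass_eq; first exact: psiN_cycles (sum_qrep_cycles y).
      exact: hw.
    by rewrite -{1}(psiN_Phi hw hx) -psiNN -psiND; apply: psiN_bounding.
  apply/ffunP => k; rewrite ffunE -[RHS]hclassK; apply/hclass_eq.
  - exact: psi_cycles (sum_qrep_cycles y).
  - exact: hx.
  - rewrite -[hrep _]/(prep x k) -(psi_Phi k hw hx) -psiNeg -psiD.
    exact: psi_bounding.
set Y := \sum_(u : Qindex n) qrep y u; case=> ew ex.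
have cY : Y \in cycles A d := sum_qrep_cycles y.
apply/hclass0 => //.
have dw : hrep w - psiN Y \in bounding N (d - 1).
  by rewrite -ew; apply: hrep_hclass; apply: psiN_cycles.
have dx k : prep x k - psi k Y \in bounding (NP k) (d - 2).
  by rewrite -ex /prep ffunE; apply: hrep_hclass; apply: psi_cycles.
(* In A, Phi differs from Y by boundaries: first through the choice of representatives, then through
   the homotopy. Finally Y bounds in K, through [star3 (qrep y)]. *)
rewrite (_ : Phi (hrep w) (prep x) =
  (Phi (hrep w) (prep x) - PhiPsi Y) - (Y - PhiPsi Y) + Y); last by zmod_solve.
apply: rpredD; first apply: rpredB.
- by apply: bounding_subset admissible_sub _; rewrite PhiPsiB; apply: Phi_bounding.
- by apply: bounding_subset admissible_sub _; apply: PhiPsi_bounding.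
apply/boundingP; exists (star3 (qrep y)); last exact: star3_boundary (qrep_cycles y).
apply: star3_chains => u; rewrite addrK.
by have /andP[] := qrep_cycles y u.
Qed.

Lemma exact_at_link d : exact_at (@inclusion d) (@link d).
Proof.
move=> z; split=> [/linkE hz|[[w x] <-]].
  pose c (u : Qindex n) := contract (edge v3 (val u)) (hrep z).
  have bc u : c u \in bounding (KQ u) (d - 1).
    have := hz u; rewrite /qrep dsum0E => h.
    (* The chosen representative of the zero class need not be 0, only a boundary. *)
    pose r := hrep (0 : homology F (KQ u) (d - 1)).
    have hr : r \in bounding (KQ u) (d - 1).
      by apply: (proj1 (hclass0 (hrep_cycle _))); exact: hclassK.
    by rewrite -(subrK r (c u)); apply: rpredD.
  have /choice[b hb] : forall u, exists b,
      b \in chains (KQ u) (d - 1 + 1) /\ boundary b = c u.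
    by move=> u; have /boundingP[b hb bE] := bc u; exists b.
  have hb1 u : b u \in chains (KQ u) d by have [] := hb u; rewrite subrK.
  have hb2 u : boundary (b u) = c u by have [] := hb u.
  have /cyclesP[hzK bz] := hrep_cycle z.
  (* Adding this boundary of K trades the part [star3 c] of the cycle for the sum of the b u, which
     lies in A; so z' is a cycle of A in the class z. *)
  pose z' := hrep z + boundary (star3 b).
  have z'E : z' = (hrep z - star3 c) + \sum_(u : Qindex n) b u.
    rewrite /z' boundary_star3; have -> : star3 (fun u => boundary (b u)) = star3 c.
      by apply: eq_bigr => u _; rewrite hb2.
    by zmod_solve.
  have cz' : z' \in cycles A d.
    apply/cyclesP; rewrite /z' boundaryD bz boundaryK addr0; split=> //.
    rewrite -/z' z'E rpredD ?star3_split // rpred_sum // => u _.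
    exact: chains_subset (KQ_sub u) (hb1 u).
  pose w := hclass N (d - 1) (psiN z').
  pose x : P F n (d - 2) := [ffun k => hclass (NP k) (d - 2) (psi k z')]
    : dsum (fun k : Pindex n => homology F (NP k) (d - 2)).
  have hw : hrep w \in cycles N (d - 1) by apply: hrep_cycle.
  have hx k : prep x k \in cycles (NP k) (d - 2) by apply: prep_cycles.
  have dw : hrep w - psiN z' \in bounding N (d - 1).
    by apply: hrep_hclass; apply: psiN_cycles.
  have dx k : prep x k - psi k z' \in bounding (NP k) (d - 2).
    by rewrite /prep ffunE; apply: hrep_hclass; apply: psi_cycles.
  exists (w, x); rewrite -[RHS]hclassK; apply/hclass_eq.
  - exact: cycles_subset admissible_sub (Phi_cycles hw hx).
  - exact: hrep_cycle.
  have -> : Phi (hrep w) (prep x) - hrep z =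
      (Phi (hrep w) (prep x) - PhiPsi z') - (z' - PhiPsi z') + boundary (star3 b).
    rewrite {2}/z'; zmod_solve.
  apply: rpredD; first apply: rpredB.
  - apply: bounding_subset admissible_sub _.
    rewrite PhiPsiB; exact: Phi_bounding.
  - by apply: bounding_subset admissible_sub _; apply: PhiPsi_bounding.
  apply/boundingP; exists (star3 b) => //.
  by apply: star3_chains => u; rewrite addrK.
have hw : hrep w \in cycles N (d - 1) by apply: hrep_cycle.
have hx k : prep x k \in cycles (NP k) (d - 2) by apply: prep_cycles.
have hPK := cycles_subset admissible_sub (Phi_cycles hw hx).
apply/ffunP => u; rewrite ffunE dsum0E; apply/hclass0.
  by apply: contract_cycles; apply: hrep_cycle.
rewrite -[hrep _](subrK (Phi (hrep w) (prep x))) contractD (contract_Phi _ hw hx) addr0.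
by apply: contract_bounding; apply: hrep_hclass.
Qed.

Lemma exact_at_connecting d : exact_at (@link d) (@connecting (d - 1)).
Proof.
move=> y; set Y := \sum_(u : Qindex n) qrep y u.
have cY : Y \in cycles A (d - 1) := sum_qrep_cycles y.
split=> [/connectingE0[bN bP]|[z /linkE hz]].
  (* If all coordinates of Y bound, so does [PhiPsi Y], and hence Y itself, by the homotopy. *)
  have /boundingP[b] : Y \in bounding A (d - 1).
    rewrite -(subrK (PhiPsi Y) Y) rpredD ?PhiPsi_bounding //.
    exact: Phi_bounding.
  (* The relative cycle [star3 (qrep y)] is closed up by a chain of A, which has no face through any
     3u and so leaves the contractions unchanged. *)
  rewrite subrK => hb bE; pose z := star3 (qrep y) - b.
  have cy u : qrep y u \in chains (KQ u) (d - 1) by have /andP[] := qrep_cycles y u.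
  have cz : z \in cycles K d.
    apply/cyclesP; split.
      by rewrite rpredB ?star3_chains // (chains_subset admissible_sub).
    by rewrite boundaryD boundaryN bE (star3_boundary (qrep_cycles y)) subrr.
  exists (hclass K d z); apply/linkE => u.
  have -> : qrep y u = contract (edge v3 (val u)) z.
    by rewrite contractD contractN (contract_star3 _ cy) (contract_star0 (val_itv4 u) hb) subr0.
  rewrite -contractN -contractD; apply: contract_bounding.
  exact: hrep_hclass.
have /cyclesP[hzK bz] := hrep_cycle z.
pose c (u : Qindex n) := contract (edge v3 (val u)) (hrep z).
have cc u : c u \in cycles (KQ u) (d - 1) := contract_cycles u (hrep_cycle z).
have bY : Y \in bounding A (d - 1).
  (* The cycle [hrep z] minus its part over the 3u is a chain of A; up to sign its boundary is the
     sum of the c u, which represents the same class as Y. *)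
  have -> : Y = - boundary (hrep z - star3 c) - (\sum_(u : Qindex n) c u - Y).
    by rewrite boundaryD boundaryN bz (star3_boundary cc); zmod_solve.
  rewrite rpredB // ?rpredN.
    apply/boundingP; exists (hrep z - star3 c) => //.
    by rewrite subrK; apply: star3_split.
  rewrite /Y -sumrB rpred_sum // => u _; apply: bounding_subset (KQ_sub u) _.
  exact: hz.
apply/connectingE0; split=> [|k]; first exact: psiN_bounding.
exact: psi_bounding.
Qed.

Lemma long_exact_sequence :
  exists (f : forall d : int, {linear Q F n d -> (H4 F n (d - 1) * P F n (d - 2))%type})
         (g : forall d : int, {linear (H4 F n (d - 1) * P F n (d - 2))%type -> Hdel F n d})
         (h : forall d : int, {linear Hdel F n d -> Q F n (d - 1)}),
  forall d : int,
    [/\ exact_at (f d) (g d), exact_at (g d) (h d)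
      & exact_at (h d) (f (d - 1))].
Proof.
exists (fun d => @connecting d : {linear _ -> _}).
exists (fun d => @inclusion d : {linear _ -> _}).
exists (fun d => @link d : {linear _ -> _}) => d; split.
- exact: exact_at_inclusion.
- exact: exact_at_link.
- exact: exact_at_connecting.
Qed.
End Operators.

Theorem theorem3p7 (F : pzRingType) (n : nat) (hn : (5 <= n)%N) :
  exists (f : forall d : int, {linear Q F n d -> (H4 F n (d - 1) * P F n (d - 2))%type})
         (g : forall d : int, {linear (H4 F n (d - 1) * P F n (d - 2))%type -> Hdel F n d})
         (h : forall d : int, {linear Hdel F n d -> Q F n (d - 1)}),
  forall d : int,
    [/\ exact_at (f d) (g d), exact_at (g d) (h d)
      & exact_at (h d) (f (d - 1))].
Proof. exact: long_exact_sequence. Qed.
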